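(* Let $G$ be a ($T_1$) sequential topological group with countable $\mathrm{cs}^*$-character. Then: $\psi(G)\le\aleph_0$; $\mathrm{sb}_\chi(G)=\chi(G)\in\{1,\aleph_0,\mathfrak d\}$; $ib(G)=c(G)=d(G)=l(G)=e(G)=nw(G)=knw(G)$; and $\mathrm{so}(G)\in\{1,\omega_1\}$.
   Context: All topological spaces (and groups) are assumed to be $T_1$. A space $X$ is sequential if a subset $A\subset X$ is closed whenever it contains the limits of all sequences of points of $A$ that converge in $X$. A family $\mathcal N$ of subsets of $X$ is a $\mathrm{cs}^*$-network at $x\in X$ if for every neighborhood $U$ of $x$ and every sequence $(x_n)\subset X$ convergent to $x$ there is $N\in\mathcal N$ with $N\subset U$ such that $x_n\in N$ for infinitely many $n$. $\mathrm{cs}^*_\chi(X)=\sup_{x\in X}\mathrm{cs}^*_\chi(X,x)$, where $\mathrm{cs}^*_\chi(X,x)$ is the smallest size of a $\mathrm{cs}^*$-network at $x$; $X$ has countable $\mathrm{cs}^*$-character if $\mathrm{cs}^*_\chi(X)\le\aleph_0$. A set $B\subset X$ is a sequential barrier at $x$ if every sequence in $X$ convergent to $x$ has all but finitely many terms in $B$. An $\mathrm{sb}$-network at $x$ is a family $\mathcal N$ of sequential barriers at $x$ such that every neighborhood $U$ of $x$ contains some $N\in\mathcal N$ (with $x\in N\subset U$). $\mathrm{sb}_\chi(X,x)$ is the smallest size of an $\mathrm{sb}$-network at $x$, and $\mathrm{sb}_\chi(X)=\sup_{x\in X}\mathrm{sb}_\chi(X,x)$. $\chi(X)$ is the character (supremum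 over points of the smallest size of a neighborhood base). $\mathfrak d$ is the cofinality of $\mathbb N^\omega$ with the coordinatewise order $(x_n)\le(y_n)$ iff $x_n\le y_n$ for all $n$. Cardinal invariants of $X$: $\psi(X)$ is the smallest $\kappa$ such that each singleton is the intersection of at most $\kappa$ open sets; $c(X)$ is the smallest $\kappa$ such that $X$ has no family of more than $\kappa$ pairwise disjoint non-empty open sets; $l(X)$ is the smallest $\kappa$ such that each open cover has a subcover of size $\le\kappa$; $d(X)$ is the smallest size of a dense subset; $e(X)$ is the smallest $\kappa$ such that $X$ has no closed discrete subspace of size $>\kappa$; $nw(X)$ is the smallest size of a family $\mathcal N$ of subsets such that for each open $U$ and $x\in U$ there is $N\in\mathcal N$ with $x\in N\subset U$; $knw(X)$ is the smallest size of a family $\mathcal N$ of subsets such that for each open $U$ and each compact $K\subset U$ there is a finite $\mathcal M\subset\mathcal N$ with $K\subset\bigcup\mathcal M\subset U$. For a topological group $G$, $ib(G)$ is the smallest cardinal $\kappa$ such that for each non-empty open $U\subset G$ there is $F\subset G$ with $|F|\le\kappa$ and $G=F\cdot U$. Sequential order: for $A\subset X$ let $A^{(1)}$ be the set of limits of all sequences of points of $A$ that converge in $X$, and for ordinals $\alpha\ge 2$ let $A^{(\alpha)}=\bigcup_{1\le\beta<\alpha}(A^{(\beta)})^{(1)}$. The sequential order $\mathrm{so}(X)$ is the smallest ordinal $\alpha\ge1$ such that $A^{(\alpha+1)}=A^{(\alpha)}$ for every $A\subset X$. *)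

(* Defs.v *)
From HB Require Import structures.
From mathcomp Require Import all_boot.
From mathcomp Require Import boolp classical_sets functions cardinality filter.
From mathcomp Require Import topology.

Set Implicit Arguments.
Unset Strict Implicit.
Unset Printing Implicit Defensive.

Local Open Scope classical_set_scope.
Local Open Scope card_scope.

HB.mixin Record isTopologicalGroup G & Group G & Topological G := {
  mulg_continuous : continuous (fun p : G * G => (p.1 * p.2)%g) ;
  invg_continuous : continuous (fun x : G => (x^-1)%g)
}.

#[short(type="topologicalGroupType")]
HB.structure Definition TopologicalGroup :=
  {G of Group G & Topological G & isTopologicalGroup G}.

(* A cardinal is represented by a type; the types K and L represent the same
   cardinal when [set: K] #= [set: L]. *)
Definition is_least_card (P : Type -> Prop) (K : Type) :=
  P K /\ forall L : Type, P L -> [set: K] #<= [set: L].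

(* By min_cardP below, the default value unit is reached only when P holds for
   no cardinal at all. *)
Definition min_card (P : Type -> Prop) : Type :=
  if pselect (exists K, is_least_card P K) is left h then sval (cid h)
  else unit.

Definition min_size (T : Type) (P : set T -> Prop) : Type :=
  min_card (fun K => exists2 A : set T, P A & A #= [set: K]).

Definition sup_card (I : Type) (f : I -> Type) : Type :=
  min_card (fun K => forall i, [set: f i] #<= [set: K]).

Lemma exists_least_set (U : Type) (Q : set (set U)) : Q !=set0 ->
  exists2 A, Q A & forall B, Q B -> A #<= B.
Proof.
move=> [A0 QA0].
pose V (S : set (set U -> U)) :=
  (forall g A, S g -> Q A -> A (g A)) /\
  (forall g h A, S g -> S h -> Q A -> g A = h A -> g = h).
have [F FV totF|S [[Sin Sinj] Smax]] := @Zorn_bigcup _ V.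
  split=> [g A [S FS Sg]|g h A [S FS Sg] [T FT Th]].
    by case: (FV _ FS) => + _; exact.
  have [/(_ _ Sg) Tg|/(_ _ Th) Sh] := totF _ _ FS FT.
    by have [_] := FV _ FT; apply.
  by have [_] := FV _ FS; apply.
have [A QA AS] : exists2 A, Q A & forall x, A x -> exists2 g, S g & g A = x.
  apply: contrapT => noA.
  have ex A : exists x, Q A -> A x /\ forall g, S g -> g A <> x.
    suff H B : Q B -> exists x, B x /\ forall g, S g -> g B <> x.
      have [QA|nQA] := pselect (Q A); last first.
        by have [x _] := H _ QA0; exists x => /nQA.
      by have [x] := H _ QA; exists x.
    move=> QB; apply: contrapT => nx; apply: noA; exists B => // x Bx.
    apply: contrapT => ng; apply: nx; exists x; split=> // g Sg gBx.
    by apply: ng; exists g.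
  have [g gP] := choice ex.
  apply: (Smax (S `|` [set g])).
    split; first by left.
    by move=> sub; have /(proj2 (gP _ QA0)) := sub g (or_intror erefl).
  split=> [h A [|->]|h k A]; [exact: Sin|by case/gP|].
  move=> [Sh|->] [Sk|->] QA //; first exact: Sinj.
    by move=> E; have := proj2 (gP _ QA) _ Sh E.
  by move=> /esym E; have := proj2 (gP _ QA) _ Sk E.
exists A => // B QB.
have {}AS x : exists g, A x -> S g /\ g A = x.
  have [/AS [g Sg gx]|nAx] := pselect (A x); first by exists g.
  by exists (fun=> x) => /nAx.
have [G GP] := choice AS.
pose f x := G x B.
have fAB : {homo f : x / A x >-> B x} by move=> x /GP [SG _]; exact: (Sin _ _ SG QB).
have finj : {in A &, injective f}.
  move=> x y /set_mem Ax /set_mem Ay fxy.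
  have [Sx ex] := GP _ Ax; have [Sy ey] := GP _ Ay.
  by rewrite -ex -ey (Sinj _ _ _ Sx Sy QB fxy).
move: (inj_card_eq finj); rewrite card_eq_le => /andP[_ /card_le_trans]; apply.
by apply: subset_card_le => _ [x Ax <-]; exact: fAB.
Qed.

Lemma card_le_total (K L : Type) :
  [set: K] #<= [set: L] \/ [set: L] #<= [set: K].
Proof.
pose iK : set (K + L) := inl @` setT; pose iL : set (K + L) := inr @` setT.
have /andP[iKK KiK] : (iK #<= [set: K]) && ([set: K] #<= iK).
  by rewrite -card_eq_le; apply: inj_card_eq => x y _ _ [].
have /andP[iLL LiL] : (iL #<= [set: L]) && ([set: L] #<= iL).
  by rewrite -card_eq_le; apply: inj_card_eq => x y _ _ [].
have [|_ [->|->] min] := @exists_least_set _ [set iK; iL].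
- by exists iK; left.
- left; apply: card_le_trans KiK (card_le_trans _ iLL).
  by apply: min; right.
- right; apply: card_le_trans LiL (card_le_trans _ iKK).
  by apply: min; left.
Qed.

Lemma exists_least_card (P : Type -> Prop) (K0 : Type) :
  P K0 -> exists K, is_least_card P K.
Proof.
move=> PK0.
have [|A [K PK AK] Amin] := @exists_least_set K0
  [set A | exists2 K, P K & A #= [set: K]].
  by exists setT, K0.
exists K; split=> // L PL.
move: AK; rewrite card_eq_le => /andP[_ /card_le_trans]; apply.
have [KL|/card_leP[f]] := card_le_total K0 L.
  exact: card_le_trans (card_leT A) KL.
pose g (x : L) : K0 := val (f (SigSub (mem_setT x))).
have gL : g @` setT #= [set: L].
  apply: inj_card_eq => x y _ _ /val_inj fxy.
  by have [] : SigSub (mem_setT x) = SigSub (mem_setT y) :> [set: L]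
    by apply: inj fxy; rewrite inE.
have Qg : exists2 K, P K & g @` setT #= [set: K] by exists L.
apply: card_le_trans (Amin _ Qg) _.
by move: gL; rewrite card_eq_le => /andP[].
Qed.

Lemma min_cardP (P : Type -> Prop) (K0 : Type) :
  P K0 -> is_least_card P (min_card P).
Proof.
move=> /exists_least_card PK; rewrite /min_card.
by case: pselect => // h; exact: svalP (cid h).
Qed.

(* An ordinal is represented by a strictly well-ordered type; the types a and b
   represent the same ordinal when ord_eq a b. *)
Record wellorder := WellOrder {
  wo_sort :> Type ;
  wo_lt : wo_sort -> wo_sort -> Prop ;
  wo_trans : forall x y z, wo_lt x y -> wo_lt y z -> wo_lt x z ;
  wo_total : forall x y, wo_lt x y \/ x = y \/ wo_lt y x ;
  wo_wf : well_founded wo_lt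
}.

Definition ord_eq (a b : wellorder) := exists2 f : a -> b,
  bijective f & forall x y, wo_lt x y <-> wo_lt (f x) (f y).

Lemma sval_inj (T : Type) (P : T -> Prop) : injective (@sval T P).
Proof. by move=> [x px] [y py] /= xy; exact: eq_exist. Qed.

Section initial_segment.
Variables (a : wellorder) (t : a).

Definition below_lt (x y : {x : a | wo_lt x t}) := wo_lt (sval x) (sval y).

Lemma below_trans x y z : below_lt x y -> below_lt y z -> below_lt x z.
Proof. exact: wo_trans. Qed.

Lemma below_total x y : below_lt x y \/ x = y \/ below_lt y x.
Proof.
have [|[xy|]] := wo_total (sval x) (sval y); [by left| |by right; right].
by right; left; apply: sval_inj.
Qed.

Lemma below_wf : well_founded below_lt.
Proof.
move=> [x xt]; elim/(well_founded_ind (@wo_wf a)): x xt => x IH xt.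
by constructor => -[y yt] yx; apply: IH.
Qed.

Definition wo_below := WellOrder below_trans below_total below_wf.

End initial_segment.

Definition ord_lt (a b : wellorder) := exists t : b, ord_eq a (wo_below t).

Definition ord_le (a b : wellorder) := ord_lt a b \/ ord_eq a b.

Section successor.
Variable a : wellorder.

Definition succ_lt (x y : option a) :=
  match x, y with
  | Some u, Some v => wo_lt u v
  | Some _, None => True
  | None, _ => False
  end.

Lemma succ_trans x y z : succ_lt x y -> succ_lt y z -> succ_lt x z.
Proof. by case: x y z => [x|] [y|] [z|] //=; exact: wo_trans. Qed.

Lemma succ_total x y : succ_lt x y \/ x = y \/ succ_lt y x.
Proof.
case: x y => [x|] [y|] /=; [|by left|by do 2 right|by right; left].
by have [|[->|]] := wo_total x y; [left|right; left|right; right].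
Qed.

Lemma succ_wf : well_founded succ_lt.
Proof.
have S x : Acc succ_lt (Some x).
  elim/(well_founded_ind (@wo_wf a)): x => x IH.
  by constructor => -[y|//] yx; exact: IH.
case=> [x|]; first exact: S.
by constructor => -[y|//] _; exact: S.
Qed.

Definition ord_succ := WellOrder succ_trans succ_total succ_wf.

End successor.

Lemma zero_trans (x y z : void) : False -> False -> False.
Proof. by []. Qed.

Lemma zero_total (x y : void) : False \/ x = y \/ False.
Proof. by case: x. Qed.

Lemma zero_wf : well_founded (fun _ _ : void => False).
Proof. by case. Qed.

Definition ordinal0 := WellOrder zero_trans zero_total zero_wf.

Definition ordinal1 := ord_succ ordinal0.

Definition is_least_ord (P : wellorder -> Prop) (a : wellorder) :=
  P a /\ forall b, ord_lt b a -> ~ P b.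

(* By least_ordP below, the default value ordinal0 is reached only when P holds for
   no ordinal at all. *)
Definition least_ord (P : wellorder -> Prop) : wellorder :=
  if pselect (exists a, is_least_ord P a) is left h then sval (cid h)
  else ordinal0.

Lemma ord_eq_below (a b : wellorder) (t : a) (u : wo_below t) :
  ord_eq b (wo_below u) -> ord_eq b (wo_below (sval u)).
Proof.
move=> [f [g fK gK] fmono].
pose F x : wo_below (sval u) :=
  exist (fun y => wo_lt y (sval u)) (sval (sval (f x))) (svalP (f x)).
have lt_t (y : wo_below (sval u)) : wo_lt (sval y) t.
  exact: wo_trans (svalP y) (svalP u).
pose H (y : wo_below (sval u)) : wo_below u :=
  exist (fun z => wo_lt z u)
    (exist (fun z => wo_lt z t) (sval y) (lt_t y)) (svalP y).
exists F => //; exists (fun y => g (H y)) => [x|y].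
  by rewrite -[RHS]fK; congr g; do 2 apply: sval_inj.
by apply: sval_inj; rewrite /= gK.
Qed.

Lemma ord_lt_transr (a b c : wellorder) :
  ord_lt a b -> ord_eq b c -> ord_lt a c.
Proof.
move=> [t [f [f' fK f'K] fmono]] [g [g' gK g'K] gmono]; exists (g t).
have gt (y : wo_below t) : wo_lt (g (sval y)) (g t).
  by apply/gmono; exact: svalP y.
have g't (y : wo_below (g t)) : wo_lt (g' (sval y)) t.
  by apply/gmono; rewrite g'K; exact: svalP y.
pose F x : wo_below (g t) :=
  exist (fun y => wo_lt y (g t)) (g (sval (f x))) (gt (f x)).
pose H (y : wo_below (g t)) : wo_below t :=
  exist (fun z => wo_lt z t) (g' (sval y)) (g't y).
exists F => [|x y]; last exact: (iff_trans (fmono x y) (gmono _ _)).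
exists (fun y => f' (H y)) => [x|y].
  by rewrite -[RHS]fK; congr f'; apply: sval_inj; rewrite /= gK.
by apply: sval_inj; rewrite /= f'K /= g'K.
Qed.

Lemma least_ordP (P : wellorder -> Prop) (a0 : wellorder) :
  P a0 -> is_least_ord P (least_ord P).
Proof.
move=> Pa0; suff: exists a, is_least_ord P a.
  by rewrite /least_ord => ex; case: pselect => // h; exact: svalP (cid h).
suff below (t : a0) b : ord_eq b (wo_below t) -> P b ->
    exists a, is_least_ord P a.
  apply: contrapT => nex; apply: (nex); exists a0; split=> // b [t bt] Pb.
  by apply: nex; exact: below bt Pb.
elim/(well_founded_ind (@wo_wf a0)): t b => t IH b bt Pb.
apply: contrapT => nex; apply: (nex); exists b; split=> // c cb Pc.
have [u cu] := ord_lt_transr cb bt.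
by apply: nex; apply: (IH (sval u) (svalP u) c) => //; exact: ord_eq_below.
Qed.

Definition omega1 : wellorder := least_ord (fun a => ~ countable [set: a]).

Definition dominating_number : Type :=
  min_size (fun D : set (nat -> nat) =>
    forall f, exists2 g, D g & forall n, (f n <= g n)%N).

Section invariants.
Variable X : topologicalType.

Definition seq_closure (A : set X) : set X :=
  [set x | exists2 u : nat -> X, forall n, A (u n) & u @ \oo --> x].

Definition sequential_space :=
  forall A : set X, seq_closure A `<=` A -> closed A.

(* seq_iter A a is A^(a) for the ordinals a >= 1, and it is empty for a = 0;
   as ord_lt is well founded, this is a definition by transfinite recursion. *)
Inductive seq_iter (A : set X) : wellorder -> X -> Prop :=
| seq_iter1 a x : ord_eq a ordinal1 -> seq_closure A x -> seq_iter A a x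
| seq_iterU a b x : ord_le ordinal1 b -> ord_lt b a ->
    seq_closure (seq_iter A b) x -> seq_iter A a x.

Definition sequential_order : wellorder :=
  least_ord (fun a => ord_le ordinal1 a /\
    forall A : set X, seq_iter A (ord_succ a) = seq_iter A a).

Definition cs_star_network (x : X) (N : set (set X)) :=
  forall (U : set X) (u : nat -> X), nbhs x U -> u @ \oo --> x ->
  exists A, [/\ N A, A `<=` U & infinite_set [set n | A (u n)]].

Definition cs_star_character : Type :=
  sup_card (fun x => min_size (cs_star_network x)).

Definition sequential_barrier (x : X) (B : set X) :=
  forall u : nat -> X, u @ \oo --> x -> \forall n \near \oo, B (u n).

Definition sb_network (x : X) (N : set (set X)) :=
  (forall B, N B -> sequential_barrier x B) /\
  (forall U, nbhs x U -> exists B, [/\ N B, B x & B `<=` U]).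

Definition sb_character : Type :=
  sup_card (fun x => min_size (sb_network x)).

Definition nbhs_base (x : X) (N : set (set X)) :=
  N `<=` nbhs x /\ (forall U, nbhs x U -> exists2 B, N B & B `<=` U).

Definition character : Type :=
  sup_card (fun x => min_size (nbhs_base x)).

Definition pseudocharacter : Type :=
  min_card (fun K => forall x : X, exists F : set (set X),
    [/\ F #<= [set: K], F `<=` open & \bigcap_(U in F) U = [set x]]).

(* Cardinals being linearly ordered, ~~ (F #<= [set: K]) says that F has more
   than K elements. *)
Definition cellularity : Type :=
  min_card (fun K => ~ exists F : set (set X),
    [/\ forall U, F U -> open U /\ U !=set0, trivIset F id &
        ~~ (F #<= [set: K])]).

Definition lindelof_number : Type :=
  min_card (fun K => forall C : set (set X),
    C `<=` open -> \bigcup_(U in C) U = setT ->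
    exists D : set (set X),
      [/\ D `<=` C, \bigcup_(U in D) U = setT & D #<= [set: K]]).

Definition density : Type := min_size (fun D : set X => dense D).

Definition extent : Type :=
  min_card (fun K => ~ exists D : set X,
    [/\ closed D, D `<=` isolated D & ~~ (D #<= [set: K])]).

Definition network (N : set (set X)) :=
  forall (U : set X) (x : X), open U -> U x ->
  exists A, [/\ N A, A x & A `<=` U].

Definition network_weight : Type := min_size network.

Definition k_network (N : set (set X)) :=
  forall U C : set X, open U -> compact C -> C `<=` U ->
  exists M : set (set X), [/\ finite_set M, M `<=` N,
    C `<=` \bigcup_(A in M) A & \bigcup_(A in M) A `<=` U].

Definition k_network_weight : Type := min_size k_network.

End invariants.

Definition boundedness_index (G : topologicalGroupType) : Type :=
  min_card (fun K => forall U : set G, open U -> U !=set0 ->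
    exists2 F : set G, F #<= [set: K] &
      [set (x * y)%g | x in F & y in U] = setT).

(* Main.v *)
(* Fix a countable cs*-network at 1 consisting of closed sets, and for a finite
   union E of its members put D = cl(E^-1 E). The argument rests on a dichotomy:
   either every neighborhood of 1 contains some D that is a sequential barrier,
   or there is a strong fan, that is, a family of sequences S_n -> 1 such that
   no sequence meeting infinitely many of the S_n converges to any point.

   In the first case G has a countable sb-network at 1. Diagonalizing along it
   gives A^(2) = A^(1) for all A, so G is Frechet-Urysohn, barriers are
   neighborhoods, and G is first countable.

   In the second case a strong fan cannot coexist with a fan of closed discrete
   sequences shrinking to 1 (multiply the two fans), so every sequence
   converging to 1 is eventually in a sequentially compact member of a countable
   family. Quotients of these sets build an increasing sequence L_n of
   sequentially compact closed sets whose union is an open subgroup H and such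
   that every sequence converging in H is eventually in some L_n. A
   sequentially compact set contains no strong fan, so the dichotomy applied
   inside L_n makes L_n first countable at 1 and totally bounded. Consequently
   H has a countable k-network and countable pseudocharacter. Barriers at 1 are
   governed by functions from nat to nat, one value for each L_n, so at most d
   of them suffice, while the strong fan shows that at least d are needed.
   Finally no L_n absorbs all sequences converging to 1, so sets of sequential
   order t can be translated off larger and larger L_n and glued along a
   sequence converging to 1, which produces every countable sequential order. *)

Require Import Defs.
From mathcomp Require Import all_boot.
From mathcomp Require Import boolp classical_sets functions cardinality filter.
From mathcomp Require Import topology.
From mathcomp Require wochoice.

Set Implicit Arguments.
Unset Strict Implicit.
Unset Printing Implicit Defensive.

Local Open Scope classical_set_scope.
Local Open Scope card_scope.

(** * Cardinals *)

(** Choosing for each point of [A] a related point of [B] is injective, because each [u] is related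
    to at most one point of [A]. No function has to be defined outside [A]. *)
Lemma card_le_rel (T U : Type) (A : set T) (B : set U) (R : U -> T -> Prop) :
  (forall u x y, A x -> A y -> R u x -> R u y -> x = y) ->
  (forall x, A x -> exists2 u, B u & R u x) -> A #<= B.
Proof.
move=> Rfun Rtot.
have ex (x : A) : exists u : B, R (val u) (val x).
  have [u Bu Ru] := Rtot _ (set_valP x).
  by exists (SigSub (mem_set Bu)).
have [f fP] := choice ex.
apply/card_leP/injfunPex; exists f => // x y _ _ fxy.
apply: val_inj; apply: (Rfun (val (f x))); try exact: set_valP.
  exact: fP.
by rewrite fxy; exact: fP.
Qed.

Lemma card_le_ex (T U : Type) (A : set T) (B : set U) : A #<= B ->
  exists R : T -> U -> Prop,
    [/\ forall x, A x -> exists2 u, B u & R x u,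
      forall x u v, R x u -> R x v -> u = v &
      forall x y u, R x u -> R y u -> x = y].
Proof.
move=> /card_leP[f].
exists (fun x u => exists2 a : A, val a = x & val (f a) = u); split.
- move=> x Ax; exists (val (f (SigSub (mem_set Ax)))); first exact: set_valP.
  by exists (SigSub (mem_set Ax)).
- by move=> x u v [a ax <-] [b bx <-]; congr (val (f _)); apply: val_inj;
    rewrite ax.
- move=> x y u [a <- au] [b <- bu]; congr val.
  by apply: (inj (f := f)); rewrite ?inE//; apply: val_inj; rewrite au.
Qed.

Lemma card_leTP (K L : Type) :
  [set: K] #<= [set: L] <-> exists f : K -> L, injective f.
Proof.
split=> [/card_le_ex[R [Rtot _ Rinj]]|[f finj]].
  have /choice[f fP] : forall k, exists u, R k u.
    by move=> k; have [//|u _ ?] := Rtot k; exists u.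
  by exists f => x y fxy; apply: (Rinj x y (f x)); rewrite // fxy.
by apply: (@card_le_rel _ _ _ _ (fun l k => f k = l)) => [u x y _ _ <- /finj
  //|x _]; exists (f x).
Qed.

(* A maximal family of injections nat -> K with disjoint ranges covers K up to a
   finite set. *)
Lemma card_prod_nat (K : Type) : [set: nat] #<= [set: K] ->
  [set: K * nat] #<= [set: K].
Proof.
move=> Kinf.
pose P := [set F : set (nat -> K) | forall f g i j, F f -> F g ->
   f i = g j -> f = g /\ i = j].
have [F FP totF f g i j [X FX Xf] [Y FY Yg]|F [FP Fmax]] := @Zorn_bigcup _ P.
  by have [XY|YX] := totF _ _ FX FY; [apply: (FP Y)|apply: (FP X)]; auto.
pose R := [set k | forall f i, F f -> f i <> k].
have Rfin : ~ ([set: nat] #<= R).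
  move=> /card_le_ex[S [Stot _ Sinj]].
  have /choice[h hP] : forall n, exists k, R k /\ S n k.
    by move=> n; have [//|u ? ?] := Stot n; exists u.
  apply: (Fmax (F `|` [set h])).
    split; first by left.
    move=> /(_ h (or_intror erefl)) Fh.
    by have [/(_ h 0 Fh)] := hP 0.
  move=> f g i j [Ff|->] [Fg|->].
  - exact: FP.
  - by move=> E; have [/(_ f i Ff)] := hP j; rewrite E.
  - by move=> E; have [/(_ g j Fg)] := hP i; rewrite E.
  - move=> E; split=> //; apply: (Sinj _ _ (h i)); first by case: (hP i).
    by rewrite E; case: (hP j).
have [f0 Ff0] : exists f, F f.
  apply: contrapT => nF; apply: Rfin; apply: card_le_trans Kinf _.
  by apply: subset_card_le => k _ f i Ff; case: nF; exists f.
have /countable_injP[r rinj] : countable R.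
  by apply: finite_set_countable; apply/finite_setPn.
pose c (i : nat) (n : nat) := pickle (i, n).
have cinj i n j m : c i n = c j m -> i = j /\ n = m.
  by move=> /(pcan_inj pickleK) [-> ->].
(* Even positions of the members of [F] code the points covered by [F]; odd positions of the single
   [f0] code the countably many remaining points [R]. *)
apply: (@card_le_rel _ _ _ _ (fun l p =>
   (exists f i, [/\ F f, f i = p.1 & l = f (c i p.2).*2]) \/
   (R p.1 /\ l = f0 (c (r p.1) p.2).*2.+1))).
- move=> u [x n] [y m] _ _ /=.
  move=> [[f [i [Ff fi ->]]]|[Rx ->]] [[g [j [Fg gj E]]]|[Ry E]].
  + have [fg /double_inj/cinj [ij nm]] := FP _ _ _ _ Ff Fg E.
    by rewrite -fi -gj fg ij nm.
  + have [_ /(congr1 odd)] := FP _ _ _ _ Ff Ff0 E.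
    by rewrite /= !odd_double.
  + have [_ /(congr1 odd)] := FP _ _ _ _ Ff0 Fg E.
    by rewrite /= !odd_double.
  + have [_ [/double_inj/cinj [ij nm]]] := FP _ _ _ _ Ff0 Ff0 E.
    by rewrite nm; congr pair; apply: rinj; rewrite ?inE.
- move=> [k n] _.
  have [Rk|nRk] := pselect (R k).
    by exists (f0 (c (r k) n).*2.+1) => //; right.
  have [f [i [Ff fi]]] : exists f i, F f /\ f i = k.
    apply: contrapT => nex; apply: nRk => f i Ff fi; apply: nex.
    by exists f, i.
  by exists (f (c i n).*2) => //; left; exists f, i.
Qed.

Lemma card_eqW (T U : Type) (A : set T) (B : set U) :
  A #= B -> A #<= B /\ B #<= A.
Proof. by rewrite card_eq_le => /andP. Qed.

Lemma card_le_anti (T U : Type) (A : set T) (B : set U) :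
  A #<= B -> B #<= A -> A #= B.
Proof. by move=> AB BA; rewrite card_eq_le AB BA. Qed.

Lemma min_card_sat (P : Type -> Prop) (K : Type) : P K -> P (min_card P).
Proof. by move=> /min_cardP[]. Qed.

Lemma min_card_le (P : Type -> Prop) (K : Type) :
  P K -> [set: min_card P] #<= [set: K].
Proof. by move=> PK; have [_] := min_cardP PK; apply. Qed.

Lemma min_size_le (T : Type) (P : set T -> Prop) (A : set T) :
  P A -> [set: min_size P] #<= A.
Proof.
move=> PA; apply: card_le_trans (proj1 (card_eqW (card_setT A))).
by apply: min_card_le; exists A => //; exact: card_setT_sym.
Qed.

Lemma min_size_sat (T : Type) (P : set T -> Prop) (A : set T) :
  P A -> exists2 B, P B & B #= [set: min_size P].
Proof.
move=> PA; apply: (@min_card_sat (fun K => exists2 B, P B & B #= [set: K]) A).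
by exists A => //; exact: card_setT_sym.
Qed.

Lemma sup_card_le (I : Type) (f : I -> Type) (K : Type) :
  (forall i, [set: f i] #<= [set: K]) -> [set: sup_card f] #<= [set: K].
Proof. exact: min_card_le. Qed.

Lemma sup_card_ge (I : Type) (f : I -> Type) (i : I) :
  [set: f i] #<= [set: sup_card f].
Proof.
(* The disjoint union is an upper bound, so the default value of [min_card] is not taken. *)
have ub j : [set: f j] #<= [set: {k & f k}].
  apply/card_leTP; exists (existT _ j).
  pose h (p : {k & f k}) := if pselect (tag p = j) is left e
    then Some (eq_rect _ f (tagged p) _ e) else None.
  have hK x : h (existT _ j x) = Some x.
    by rewrite /h; case: pselect => // e; rewrite (Prop_irrelevance e erefl).
  by move=> x y xy; apply: Some_inj; rewrite -!hK xy.
exact: (@min_card_sat (fun K => forall j, [set: f j] #<= [set: K]) _ ub i).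
Qed.

(** * Well-orders *)

Lemma wo_irr (a : wellorder) (x : a) : ~ wo_lt x x.
Proof. by elim/(well_founded_ind (@wo_wf a)): x => x IH xx; exact: (IH x). Qed.

Lemma wo_least (a : wellorder) (P : set a) : P !=set0 ->
  exists2 x, P x & forall y, P y -> ~ wo_lt y x.
Proof.
move=> [x Px]; apply: contrapT => nex.
elim/(well_founded_ind (@wo_wf a)): x Px => x IH Px.
by apply: nex; exists x => // y Py yx; exact: IH yx Py.
Qed.

Lemma wo_nlt (a : wellorder) (x y : a) : ~ wo_lt x y -> y = x \/ wo_lt y x.
Proof. by have [|[->|]] := wo_total x y; auto. Qed.

Lemma ord_eq_mono (a b : wellorder) (f : a -> b) :
  (forall x y, wo_lt x y -> wo_lt (f x) (f y)) ->
  (forall y, exists x, f x = y) -> ord_eq a b.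
Proof.
move=> fmono fsurj.
have finj x y : f x = f y -> x = y.
  by have [/fmono|[//|/fmono]] := wo_total x y => + fxy; rewrite fxy => /wo_irr.
have [g gK] := choice fsurj.
exists f; first by exists g => // x; apply: finj; rewrite gK.
move=> x y; split=> [|fxy]; first exact: fmono.
have [//|[xy|/fmono yx]] := wo_total x y.
  by move: fxy; rewrite xy => /wo_irr.
by have /wo_irr := wo_trans fxy yx.
Qed.

Lemma ord_eq_refl a : ord_eq a a.
Proof. by apply: (@ord_eq_mono _ _ id) => // y; exists y. Qed.

Lemma ord_eq_sym a b : ord_eq a b -> ord_eq b a.
Proof.
move=> [f [g fK gK] fmono]; exists g; first by exists f.
by move=> x y; split=> [xy|/fmono]; [apply/fmono|]; rewrite !gK.
Qed.

Lemma ord_eq_trans a b c : ord_eq a b -> ord_eq b c -> ord_eq a c.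
Proof.
move=> [f [f' fK f'K] fmono] [g [g' gK g'K] gmono]; exists (g \o f).
  by exists (f' \o g'); exact: can_comp.
by move=> x y; exact: (iff_trans (fmono x y) (gmono _ _)).
Qed.

Lemma ord_eq_lt a b c : ord_eq a b -> ord_lt b c -> ord_lt a c.
Proof. by move=> ab [t bt]; exists t; exact: ord_eq_trans bt. Qed.

Lemma ord_lt_below (a : wellorder) (s t : a) :
  wo_lt s t -> ord_lt (wo_below s) (wo_below t).
Proof.
move=> st; pose u : wo_below t := exist (fun x => wo_lt x t) s st; exists u.
have lt (x : wo_below s) : wo_lt (sval x) t by exact: wo_trans (svalP x) st.
pose f (x : wo_below s) : wo_below u := exist (fun y => wo_lt y u)
  (exist (fun x => wo_lt x t) (sval x) (lt x)) (svalP x).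
apply: (@ord_eq_mono _ _ f) => // -[[y yt] ys].
by exists (exist _ y ys); do 2 apply: sval_inj.
Qed.

Lemma ord_lt_belowP (a b : wellorder) (t : a) : ord_lt b (wo_below t) ->
  exists2 s, wo_lt s t & ord_eq b (wo_below s).
Proof. by move=> [u bu]; exists (sval u); [exact: svalP u|exact: ord_eq_below].
  Qed.

Lemma ord_lt_trans a b c : ord_lt a b -> ord_lt b c -> ord_lt a c.
Proof.
move=> ab [t bt]; have [s st ?] := ord_lt_belowP (ord_lt_transr ab bt).
by exists s.
Qed.

(** An isomorphism [f] onto the segment below [t] sends [t] below itself, and [f x < x] implies
    [f (f x) < f x]: an infinite descent. *)
Lemma ord_lt_irr a : ~ ord_lt a a.
Proof.
move=> [t [f _ fmono]].
suff H x : ~ wo_lt (sval (f x)) x by apply: (H t); exact: svalP (f t).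
elim/(well_founded_ind (@wo_wf a)): x => x IH fx; apply: (IH _ fx).
exact/(fmono (sval (f x)) x).
Qed.

Lemma below_inj (a b : wellorder) (s : a) (t u : b) :
  ord_eq (wo_below s) (wo_below t) -> ord_eq (wo_below s) (wo_below u) -> t = u.
Proof.
move=> st su; have tu := ord_eq_trans (ord_eq_sym st) su.
have [/ord_lt_below lt|[//|/ord_lt_below lt]] := wo_total t u.
  by case: (ord_lt_irr (ord_lt_transr lt (ord_eq_sym tu))).
by case: (ord_lt_irr (ord_lt_transr lt tu)).
Qed.

Lemma ord_eq_below_lt (a b : wellorder) (s s' : a) (t : b) :
  ord_eq (wo_below s) (wo_below t) -> wo_lt s' s ->
  exists2 t', wo_lt t' t & ord_eq (wo_below s') (wo_below t').
Proof.
by move=> st /ord_lt_below s's; exact: ord_lt_belowP (ord_lt_transr s's st).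
Qed.

(** Matching segments defines an increasing map with downward closed range; it is onto [b] or onto
    the segment below the least missed point. *)
Lemma ord_le_embed (a b : wellorder) :
  (forall s : a, exists t : b, ord_eq (wo_below s) (wo_below t)) ->
  ord_lt a b \/ ord_eq a b.
Proof.
move=> /choice[f fP].
have fmono x y : wo_lt x y -> wo_lt (f x) (f y).
  move=> xy; have [t tfy xt] := ord_eq_below_lt (fP y) xy.
  by rewrite (below_inj (fP x) xt).
have [fsurj|/existsNP nsurj] := pselect (forall y, exists x, f x = y).
  by right; exact: ord_eq_mono fsurj.
have [t /= nt tmin] := wo_least nsurj.
have ft x : wo_lt (f x) t.
  have [//|[xt|tx]] := wo_total (f x) t; first by case: nt; exists x.
  have [x' _ tx'] := ord_eq_below_lt (ord_eq_sym (fP x)) tx.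
  by case: nt; exists x'; exact: below_inj (fP x') (ord_eq_sym tx').
left; exists t.
pose F x : wo_below t := exist (fun y => wo_lt y t) (f x) (ft x).
apply: (@ord_eq_mono _ _ F) => [x y /fmono //|[y yt]].
have [x fxy] : exists x, f x = y by apply: contrapT => ny; exact: tmin yt.
by exists x; apply: sval_inj.
Qed.

(** If each order has a point without a partner, the least such points [s] and [t] have isomorphic
    segments below them, so they are partners after all. *)
Lemma ord_trichotomy a b : ord_lt a b \/ ord_eq a b \/ ord_lt b a.
Proof.
pose R (s : a) (t : b) := ord_eq (wo_below s) (wo_below t).
have [/ord_le_embed[|]|/existsNP na] := pselect (forall s, exists t, R s t);
  auto.
have [tot|/existsNP nb] := pselect (forall t, exists s, R s t).
  have /ord_le_embed : forall t : b, exists s : a, ord_eq (wo_below t) (wo_below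
    s).
    by move=> t; have [s /ord_eq_sym] := tot t; exists s.
  by case=> [|/ord_eq_sym]; auto.
have [s ns smin] := wo_least na; have [t nt tmin] := wo_least nb.
suff st : R s t by case: ns; exists t.
have lta x : wo_lt x s -> exists2 y, wo_lt y t & R x y.
  move=> xs; have [y xy] : exists y, R x y by apply: contrapT => nx;
    exact: smin xs.
  have [yt|[yt|ty]] := wo_total y t; first by exists y.
    by case: nt; exists x; rewrite -yt.
  by have [x' _ /ord_eq_sym x't] := ord_eq_below_lt (ord_eq_sym xy) ty;
    case: nt; exists x'.
have ltb y : wo_lt y t -> exists2 x, wo_lt x s & R x y.
  move=> yt; have [x xy] : exists x, R x y by apply: contrapT => nx;
    exact: tmin yt.
  have [xs|[xs|sx]] := wo_total x s; first by exists x.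
    by case: (ns); exists y; rewrite -xs.
  by have [y' _ sy'] := ord_eq_below_lt xy sx; case: (ns); exists y'.
have /choice[F FP] (x : wo_below s) : exists y : wo_below t,
  R (sval x) (sval y).
  case: x => x xs; have [y yt xy] := lta x xs.
  by exists (exist _ y yt).
apply: (@ord_eq_mono _ _ F) => [[x xs] [x' x's] xx'|[y yt]].
  have [y yy' xy] := ord_eq_below_lt (FP (exist _ x' x's)) xx'.
  by rewrite /= /below_lt -(below_inj xy (FP (exist _ x xs))).
have [x xs xy] := ltb y yt; exists (exist _ x xs); apply: sval_inj.
exact: below_inj (FP (exist _ x xs)) xy.
Qed.

Lemma ord_le_inhabited (a : wellorder) : a -> ord_le ordinal1 a.
Proof.
move=> x; have [|[|[t [f _ _]]]] := ord_trichotomy ordinal1 a; rewrite /ord_le;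
  auto.
by have := svalP (f x); case: (sval (f x)) => [[]|].
Qed.

Lemma ord_le1_inhabited (a : wellorder) : ord_le ordinal1 a -> exists x : a,
  True.
Proof. by move=> [[t _]|[f _ _]]; [exists t|exists (f None)]. Qed.

Lemma ord_le1_below (a : wellorder) (t : a) :
  ord_le ordinal1 (wo_below t) <-> exists s, wo_lt s t.
Proof.
split=> [/ord_le1_inhabited[[s st] _]|[s st]]; first by exists s.
exact: (@ord_le_inhabited (wo_below t) (exist _ s st)).
Qed.

Lemma ord_eq_below_None a : ord_eq (@wo_below (ord_succ a) None) a.
Proof.
apply: ord_eq_sym.
pose f (x : a) : @wo_below (ord_succ a) None :=
  exist (fun y : ord_succ a => wo_lt y None) (Some x) I.
by apply: (@ord_eq_mono _ _ f) => // -[[x|//] xN]; exists x; apply: sval_inj.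
Qed.

Lemma ord_lt_succ a : ord_lt a (ord_succ a).
Proof. by exists None; apply/ord_eq_sym/ord_eq_below_None. Qed.

Lemma ord_lt_succP a b : ord_lt b (ord_succ a) <-> ord_le b a.
Proof.
split=> [[[t|] bt]|[ba|ba]].
- left; exists t; apply: ord_eq_trans bt _.
  have Sb (y : @wo_below (ord_succ a) (Some t)) : exists2 x, wo_lt x t &
    sval y = Some x.
    by case: y => -[x|] // xt; exists x.
  have mono (x : wo_below t) : @wo_lt (ord_succ a) (Some (sval x)) (Some t).
    exact: svalP x.
  pose f (x : wo_below t) : @wo_below (ord_succ a) (Some t) :=
    exist (fun y : ord_succ a => wo_lt y (Some t)) (Some (sval x)) (mono x).
  apply: ord_eq_sym; apply: (@ord_eq_mono _ _ f) => // y.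
  have [x xt yx] := Sb y; exists (exist _ x xt); apply: sval_inj.
  by rewrite yx.
- by right; exact: ord_eq_trans bt (ord_eq_below_None a).
- exact: ord_lt_trans ba (ord_lt_succ a).
- exact: ord_eq_lt ba (ord_lt_succ a).
Qed.

(** The power set of [nat] is well-ordered by choice, and Cantor's diagonal set shows that it is
    uncountable. *)
Lemma exists_uncountable_wellorder : exists a : wellorder, ~ countable [set: a].
Proof.
have [R Rwo] := wochoice.well_ordering_principle (set nat).
have Rmin (A : set (set nat)) : A !=set0 -> exists2 x, A x & forall y, A y ->
  R x y.
  move=> [x Ax]; have [|z [[zA zmin] _]] := Rwo (mem A).
    by exists x; apply: mem_set.
  by exists z => [|y Ay]; [exact: set_mem|apply: zmin; exact: mem_set].
(* Only unique least elements of non-empty sets are given: pairs yield antisymmetry and totality,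
   triples yield transitivity. *)
have Ranti x y : R x y -> R y x -> x = y.
  move=> xy yx; have Rr z : R z z by have [|w -> ->] := Rmin [set z];
    first by exists z.
  have [|z [_ zuniq]] := Rwo (mem [set x; y]); first by exists x;
    apply: mem_set; left.
  have mx : x \in mem [set x; y] by apply: mem_set; left.
  have my : y \in mem [set x; y] by apply: mem_set; right.
  by rewrite -(zuniq x) ?(zuniq y)//; split=> // w /set_mem[->|->].
have Rtot x y : R x y \/ R y x.
  have [|z [->|->] zmin] := Rmin [set x; y]; first by exists x; left.
    by left; apply: zmin; right.
  by right; apply: zmin; left.
pose lt x y := R x y /\ x <> y.
have lt_wf : well_founded lt.
  move=> x; apply: contrapT => nx.
  have [|z nz zmin] := Rmin [set x | ~ Acc lt x]; first by exists x.
  apply: nz; constructor => y [yz ne]; apply: contrapT => /zmin zy.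
  by apply: ne; exact: Ranti.
have lt_total x y : lt x y \/ x = y \/ lt y x.
  have [|xy] := pselect (x = y); first by auto.
  by have [] := Rtot x y; [left|right; right]; split=> // /esym.
have lt_trans x y z : lt x y -> lt y z -> lt x z.
  move=> xy yz; have [//|[xz|zx]] := lt_total x z.
    by move: yz; rewrite -xz => yx; case: xy => [/Ranti nxy]; case; apply: nxy;
      case: yx.
  have [w [->|[->|->]] wmin] : exists2 w, w = x \/ w = y \/ w = z & forall v,
    v = x \/ v = y \/ v = z -> R w v.
    by apply: Rmin; exists x; left.
  - by case: zx => zx; case; apply: Ranti => //; apply: wmin; auto.
  - by case: xy => xy; case; apply: Ranti => //; apply: wmin; auto.
  - by case: yz => yz; case; apply: Ranti => //; apply: wmin; auto.
exists (WellOrder lt_trans lt_total lt_wf) => /= /card_leTP[f finj].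
pose D := [set n | exists2 A : set nat, f A = n & ~ A n].
have [DfD|nDfD] := pselect (D (f D)).
  by have [A /finj -> /(_ DfD)] := DfD.
by apply: (nDfD); exists D.
Qed.

Lemma omega1P : is_least_ord (fun a => ~ countable [set: a]) omega1.
Proof.
have [a na] := exists_uncountable_wellorder.
exact: (@least_ordP (fun a => ~ countable [set: a]) a).
Qed.

Lemma lt_omega1_countable a : ord_lt a omega1 -> countable [set: a].
Proof. by move=> /(proj2 omega1P) /contrapT. Qed.

(** Otherwise [omega1] would be a countable union of initial segments, each countable by the
    minimality of [omega1]. *)
Lemma omega1_countable_bound (t : nat -> omega1) :
  exists u : omega1, forall n, wo_lt (t n) u.
Proof.
have cnt : countable (\bigcup_n [set s : omega1 | wo_lt s (t n) \/ s = t n]).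
  apply: bigcup_countable => // n _.
  have -> : [set s : omega1 | wo_lt s (t n) \/ s = t n] =
    (sval @` [set: wo_below (t n)]) `|` [set t n].
    apply/seteqP; split=> s [st|->]; [left|right|left|right] => //.
      by exists (exist _ s st).
    by case: st => -[x xt] _ <-.
  rewrite -bigcup2E; apply: bigcup_countable => // -[|[|k]] _ /=;
    rewrite ?countable0//.
    apply: card_le_trans (card_image_le _ _) _.
    have tn : ord_lt (wo_below (t n)) omega1 by exists (t n);
      exact: ord_eq_refl.
    exact: (lt_omega1_countable tn).
apply: contrapT => nex; apply: (proj1 omega1P).
suff -> : [set: omega1] = \bigcup_n [set s : omega1 | wo_lt s (t n) \/
  s = t n] by [].
apply/seteqP; split=> // u _; apply: contrapT => nu; apply: nex; exists u => n.
have [//|[tu|ut]] := wo_total (t n) u; first by case: nu; exists n => //; right.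
by case: nu; exists n => //; left.
Qed.

(** * Iterated sequential closures *)

(** Every ordinal below [a] is represented by a segment of [a], so the induction runs over the
    points of [a]. *)
Lemma ord_ind (P : wellorder -> Prop) :
  (forall a, (forall b, ord_lt b a -> P b) -> P a) -> forall a, P a.
Proof.
move=> IH a.
suff H (t : a) b : ord_eq b (wo_below t) -> P b.
  by apply: IH => b [t /H].
elim/(well_founded_ind (@wo_wf a)): t b => t IHt b bt.
apply: IH => c cb; have [s st cs] := ord_lt_belowP (ord_lt_transr cb bt).
exact: IHt cs.
Qed.

Lemma seq_closure_sub (X : topologicalType) (A : set X) : A `<=` seq_closure A.
Proof. by move=> x Ax; exists (fun=> x) => //; exact: cvg_cst. Qed.

Lemma seq_closureS (X : topologicalType) (A B : set X) :
  A `<=` B -> seq_closure A `<=` seq_closure B.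
Proof. by move=> AB x [u Au ux]; exists u => // n; exact: AB. Qed.

Section seq_iter.
Variable X : topologicalType.
Implicit Types A B : set X.

Lemma seq_iter_eq A a b x : ord_eq a b -> seq_iter A a x -> seq_iter A b x.
Proof.
move=> + xA; case: xA => [c y cE Ay|c d y d1 dc Ay] ab.
  by apply: seq_iter1 => //; exact: ord_eq_trans (ord_eq_sym ab) cE.
by apply: seq_iterU Ay => //; exact: ord_lt_transr ab.
Qed.

Lemma ord_le_lt_trans a b c : ord_le a b -> ord_lt b c -> ord_lt a c.
Proof. by move=> [|] ab; [exact: ord_lt_trans|exact: ord_eq_lt]. Qed.

Lemma seq_iter_ge1 A a x : seq_iter A a x -> ord_le ordinal1 a.
Proof.
move=> [c _ cE _|c d _ d1 dc _]; first by right; exact: ord_eq_sym.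
by left; exact: ord_le_lt_trans dc.
Qed.

Lemma seq_iter_mono A a b : ord_le a b -> seq_iter A a `<=` seq_iter A b.
Proof.
move=> [ab|ab] x Ax; last exact: seq_iter_eq Ax.
by apply: (seq_iterU (seq_iter_ge1 Ax) ab); exact: seq_closure_sub.
Qed.

Lemma seq_iter_ordinal1 A : seq_iter A ordinal1 = seq_closure A.
Proof.
apply/seteqP; split=> x; last by apply: seq_iter1; exact: ord_eq_refl.
move E : ordinal1 => o xA; case: xA E => // a b y b1 ba _ oa.
have := ord_le_lt_trans b1 ba; rewrite -oa => /ord_lt_irr [].
Qed.

Lemma seq_iter_succ A a : ord_le ordinal1 a ->
  seq_iter A (ord_succ a) = seq_closure (seq_iter A a).
Proof.
move=> a1; apply/seteqP; split=> x; last first.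
  by apply: seq_iterU => //; exact: ord_lt_succ.
move E : (ord_succ a) => o xA; case: xA E => [c y c1 _ oc|c b y b1 bc Ay oc].
  have := ord_le_lt_trans a1 (ord_lt_succ a); rewrite oc => lt.
  by have /ord_lt_irr := ord_lt_transr lt c1.
by apply: seq_closureS Ay; apply: seq_iter_mono; apply/ord_lt_succP; rewrite oc.
Qed.

Lemma seq_iter_gt0 A a : ord_le ordinal1 a -> seq_closure A `<=` seq_iter A a.
Proof. by move=> a1; rewrite -seq_iter_ordinal1; exact: seq_iter_mono. Qed.

Lemma sequential_order1 :
  (forall A, seq_closure (seq_closure A) `<=` seq_closure A) ->
  ord_eq (sequential_order X) ordinal1.
Proof.
move=> clcl; pose P a := ord_le ordinal1 a /\
  forall A, seq_iter A (ord_succ a) = seq_iter A a.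
have o1 : ord_le ordinal1 ordinal1 by right; exact: ord_eq_refl.
have Po1 : P ordinal1.
  split=> // A; rewrite seq_iter_succ// seq_iter_ordinal1.
  by apply/seteqP; split; [exact: clcl|exact: seq_closure_sub].
have [[[lt|/ord_eq_sym //] _] min] := least_ordP Po1.
by case: (min _ lt).
Qed.

(** Each term of the sequence enters at a countable stage, and countably many stages have a bound
    [v] in [omega1]; the limit is then in the sequential closure of stage [v]. *)
Lemma seq_iter_omega1_closed A :
  seq_closure (seq_iter A omega1) `<=` seq_iter A omega1.
Proof.
have big (u : omega1) : exists v, wo_lt u v.
  by have [v /(_ 0)] := omega1_countable_bound (fun=> u); exists v.
have [t0 t0P] : exists t0 : omega1, ord_le ordinal1 (wo_below t0).
  apply: contrapT => n0; apply: (proj1 omega1P).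
  suff -> : [set: omega1] = set0 by [].
  apply/seteqP; split=> // t _; apply: n0; have [v tv] := big t.
  by exists v; apply/ord_le1_below; exists t.
have lt1 (t : omega1) : ord_lt (wo_below t) omega1.
  by exists t; exact: ord_eq_refl.
move=> x [u Au ux].
have stage n : exists t : omega1, seq_iter A (wo_below t) (u n).
  have := Au n; move E : {1}omega1 => o xA.
  case: xA E => [c y c1 Ay oc|c b y b1 bc Ay oc].
    by exists t0; exact: seq_iter_gt0.
  rewrite -oc in bc.
  have [t bt] := bc; have [v tv] := big t; exists v.
  apply: (seq_iterU _ (ord_lt_below tv)); first by case: b1 => [b1|b1]; [left;
    apply: ord_lt_transr bt|right; apply: ord_eq_trans bt].
  by apply: seq_closureS Ay => y'; exact: seq_iter_eq.
have [t tP] := choice stage; have [v tv] := omega1_countable_bound t.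
have Av n : seq_iter A (wo_below v) (u n).
  by apply: seq_iter_mono (tP n); left; exact: ord_lt_below.
apply: (seq_iterU (seq_iter_ge1 (Av 0)) (lt1 v)).
by exists u.
Qed.

(** The iteration has always stopped at [omega1]; an earlier stop would be at a countable ordinal,
    which the hypothesis rules out. *)
Lemma sequential_order_omega1 :
  (forall a, ord_le ordinal1 a -> countable [set: a] ->
    exists A, seq_iter A (ord_succ a) <> seq_iter A a) ->
  ord_eq (sequential_order X) omega1.
Proof.
move=> nstop; pose P a := ord_le ordinal1 a /\
  forall A, seq_iter A (ord_succ a) = seq_iter A a.
have Pw : P omega1.
  have w1 : ord_le ordinal1 omega1.
    apply: contrapT => n1; apply: (proj1 omega1P).
    suff -> : [set: omega1] = set0 by [].
    by apply/seteqP; split=> // t _; apply: n1; exact: ord_le_inhabited.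
  split=> // A; rewrite seq_iter_succ//.
  by apply/seteqP; split; [exact: seq_iter_omega1_closed|exact:
    seq_closure_sub].
have [[so1 soP] somin] := least_ordP Pw.
rewrite -/(sequential_order X) in so1 soP somin.
have [lt|[//|/somin//]] := ord_trichotomy (sequential_order X) omega1.
by have [A] := nstop _ so1 (lt_omega1_countable lt); rewrite soP.
Qed.

End seq_iter.

Lemma seq_iter_continuous (X Y : topologicalType) (f : X -> Y) (A : set X) (B :
  set Y) a :
  continuous f -> (forall x, A x -> B (f x)) ->
  forall x, seq_iter A a x -> seq_iter B a (f x).
Proof.
move=> fc AB; elim/ord_ind: a => a IH x.
have cl A' B' y : (forall z, A' z -> B' (f z)) -> seq_closure A' y ->
  seq_closure B' (f y).
  move=> AB' [u Au uy]; exists (f \o u) => [n|]; first exact: AB'.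
  by apply: cvg_comp uy _; exact: fc.
move=> xA; case: xA IH => [c y c1 Ay _|c b y b1 bc Ay IH].
  by apply: seq_iter1 => //; exact: cl Ay.
by apply: (seq_iterU b1 bc); apply: cl Ay => z; exact: IH.
Qed.

(** * Sequences and topological groups *)

Lemma cvg_seqP (X : topologicalType) (u : nat -> X) (x : X) :
  u @ \oo --> x <->
  forall U, nbhs x U -> exists N, forall n, (N <= n)%N -> U (u n).
Proof.
split=> [ux U /ux [N _ NU]|ux U /ux [N NU]]; first by exists N => n /NU.
by exists N => // n /NU.
Qed.

Lemma cvg_subseq (X : topologicalType) (u : nat -> X) (x : X) (h : nat -> nat) :
  (forall n, (n <= h n)%N) -> u @ \oo --> x -> (u \o h) @ \oo --> x.
Proof.
move=> hn /cvg_seqP ux; apply/cvg_seqP => U /ux [N NU]; exists N => n Nn.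
by apply: NU; exact: leq_trans (hn n).
Qed.

Lemma infinite_natP (P : set nat) :
  infinite_set P <-> forall N, exists2 n, (N <= n)%N & P n.
Proof.
split=> [Pinf N|Pcof Pfin].
  apply: contrapT => nex; apply: Pinf.
  apply: (@sub_finite_set _ _ `I_N); last exact: finite_II.
  move=> n Pn /=; rewrite ltnNge; apply/negP => Nn; apply: nex; by exists n.
have [N PN] : exists N, forall n, P n -> (n < N)%N.
  have /finite_seqP[s sP] := Pfin.
  exists (\max_(i <- s) i).+1 => n Pn; rewrite ltnS.
  by apply: leq_bigmax_seq => //; move: Pn; rewrite sP.
by have [n Nn /PN] := Pcof N; rewrite ltnNge Nn.
Qed.

Lemma increasing_sub (P : nat -> nat -> Prop) :
  (forall k N, exists2 n, (N <= n)%N & P k n) ->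
  exists h : nat -> nat, (forall n, P n (h n)) /\
    (forall m n, (m < n)%N -> (h m < h n)%N).
Proof.
move=> Pcof.
have /choice[c cP] : forall kN : nat * nat, exists n, (kN.2 <= n)%N /\ P kN.1 n.
  by move=> [k N]; have [n ? ?] := Pcof k N; exists n.
pose h := fix h n := if n is n'.+1 then c (n, (h n').+1) else c (0, 0).
exists h; split=> [[|n]|]; [exact: (cP (0, 0)).2|exact: (cP (n.+1,
  (h n).+1)).2|].
move=> m n; apply: (@homo_ltn _ h (fun a b => (a < b)%N)) => [? ? ?|{}n].
  exact: ltn_trans.
exact: (cP (n.+1, (h n).+1)).1.
Qed.

Lemma increasing_ge (h : nat -> nat) :
  (forall m n, (m < n)%N -> (h m < h n)%N) -> forall n, (n <= h n)%N.
Proof. by move=> hi; elim=> // n /leq_ltn_trans; apply; exact: hi. Qed.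

Lemma infinite_sub (P : set nat) : (forall N, exists2 n, (N <= n)%N & P n) ->
  exists h : nat -> nat, [/\ forall n, P (h n), forall n, (n <= h n)%N &
    forall m n, (m < n)%N -> (h m < h n)%N].
Proof.
move=> /(fun H => @increasing_sub (fun=> P) (fun=> H))[h [hP hi]].
by exists h; split=> //; exact: increasing_ge.
Qed.

(** Recursion on the whole history: the values below [n] are stored in the list [s n], and the
    second hypothesis says that [P n] looks only at these. *)
Lemma history_choice (T : Type) (P : nat -> (nat -> T) -> T -> Prop) (t0 : T) :
  (forall n f, exists x, P n f x) ->
  (forall n f g x, (forall i, (i < n)%N -> f i = g i) -> P n f x -> P n g x) ->
  exists f : nat -> T, forall n, P n f (f n).
Proof.
move=> Pex Pext.
have /choice[c cP] : forall nf : nat * (nat -> T), exists x, P nf.1 nf.2 x.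
  by move=> [n f]; exact: Pex.
pose s := fix s n : seq T := if n is m.+1
  then rcons (s m) (c (m, nth t0 (s m))) else [::].
have szs n : size (s n) = n by elim: n => //= n IH; rewrite size_rcons IH.
have nths n i : (i < n)%N -> nth t0 (s n) i = c (i, nth t0 (s i)).
  elim: n => // n IH; rewrite ltnS leq_eqVlt => /predU1P[->|lin] /=.
    by rewrite nth_rcons szs ltnn eqxx.
  by rewrite nth_rcons szs lin IH.
exists (fun n => c (n, nth t0 (s n))) => n.
by apply: Pext (cP (n, nth t0 (s n))) => i lin /=; rewrite nths.
Qed.

Section topological_group.
Variable G : topologicalGroupType.
Implicit Types (x y z : G) (A B U V : set G) (u v : nat -> G).
Local Notation "1" := (1%g : G).

Lemma nbhs_mulg x y U : nbhs (x * y)%g U -> exists V W,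
  [/\ nbhs x V, nbhs y W & forall a b, V a -> W b -> U (a * b)%g].
Proof.
move=> /(@mulg_continuous G (x, y)) [[V W] /= [xV yW] VWU].
by exists V, W; split=> // a b Va Wb; apply: (VWU (a, b)).
Qed.

Lemma nbhs_invg x U : nbhs (x^-1)%g U -> nbhs x [set y | U (y^-1)%g].
Proof. exact: (@invg_continuous G x). Qed.

Lemma nbhs_lmulg a x U : nbhs (a * x)%g U -> nbhs x [set y | U (a * y)%g].
Proof.
move=> /nbhs_mulg[V [W [aV xW VWU]]]; apply: filterS xW => y Wy.
by apply: VWU => //; exact: nbhs_singleton.
Qed.

Lemma nbhs1_lmulg x U : nbhs 1 U -> nbhs x [set y | U (x^-1 * y)%g].
Proof. by move=> U1; apply: nbhs_lmulg; rewrite mulVg. Qed.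

Lemma nbhs_to1 x U : nbhs x U -> nbhs 1 [set y | U (x * y)%g].
Proof. by move=> xU; apply: nbhs_lmulg; rewrite mulg1. Qed.

Lemma nbhs1_mul U : nbhs 1 U -> exists V, [/\ nbhs 1 V,
  forall a, V a -> V (a^-1)%g & forall a b, V a -> V b -> U (a * b)%g].
Proof.
move=> U1; have /nbhs_mulg[V [W [V1 W1 VWU]]] : nbhs (1 * 1)%g U by rewrite
  mulg1.
have VW : nbhs 1 (V `&` W) by exact: filterI.
exists ((V `&` W) `&` [set y | (V `&` W) (y^-1)%g]); split.
- by apply: filterI => //; apply: (@nbhs_invg 1 (V `&` W)); rewrite invg1.
- by move=> a [Va Va']; split=> //=; rewrite invgK.
- by move=> a b [[Va _] _] [[_ Wb] _]; exact: VWU.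
Qed.

Lemma nbhs1_sub U : nbhs 1 U -> exists V, [/\ nbhs 1 V,
  forall a, V a -> V (a^-1)%g, V `<=` U & forall a b, V a -> V b ->
    U (a * b)%g].
Proof.
move=> /nbhs1_mul[V [V1 Vi VU]]; exists V; split=> // a Va.
by rewrite -[a]mulg1; apply: VU => //; exact: nbhs_singleton.
Qed.

(** Regularity of groups: if [y] and [x^-1 * y] are in the symmetric set [V], then [x] is a product
    of two elements of [V]. *)
Lemma nbhs1_closure U : nbhs 1 U -> exists V, [/\ nbhs 1 V,
  forall a, V a -> V (a^-1)%g & closure V `<=` U].
Proof.
move=> /nbhs1_mul[V [V1 Vi VU]]; exists V; split=> // x clx.
have [y [Vy]] := clx _ (nbhs1_lmulg x V1).
rewrite /= => /Vi; rewrite invgM invgK => xy.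
by rewrite -(mulVKg y x); exact: VU.
Qed.

Lemma cvgMg u v x y : u @ \oo --> x -> v @ \oo --> y ->
  (fun n => u n * v n)%g @ \oo --> (x * y)%g.
Proof.
move=> /cvg_seqP ux /cvg_seqP vy; apply/cvg_seqP => U /nbhs_mulg[V [W [xV yW
  VWU]]].
have [N NV] := ux _ xV; have [M MW] := vy _ yW.
by exists (maxn N M) => n; rewrite geq_max => /andP[Nn Mn]; apply: VWU; auto.
Qed.

Lemma cvgVg u x : u @ \oo --> x -> (fun n => (u n)^-1)%g @ \oo --> (x^-1)%g.
Proof. by move=> ux; apply: cvg_comp ux _; exact: invg_continuous. Qed.

Lemma cvg_lmulg a u x : u @ \oo --> x -> (fun n => a * u n)%g @ \oo -->
  (a * x)%g.
Proof. by apply: cvgMg; exact: cvg_cst. Qed.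

Lemma cvg_to1 u x : u @ \oo --> x -> (fun n => x^-1 * u n)%g @ \oo --> 1.
Proof. by move=> /(@cvg_lmulg (x^-1)%g); rewrite mulVg. Qed.

Lemma continuous_lmulg a : continuous (fun x : G => (a * x)%g).
Proof. by move=> x U /nbhs_lmulg. Qed.

Hypothesis T1 : accessible_space G.

Lemma nbhs_neq x y : x <> y -> nbhs x [set z | z <> y].
Proof.
move=> xy; have : nbhs x (~` [set y]).
  by apply: open_nbhs_nbhs; split=> //; apply: closed_openC;
    exact: accessible_closed_set1.
by apply: filterS => z.
Qed.

Lemma cvg_uniq u x y : u @ \oo --> x -> u @ \oo --> y -> x = y.
Proof.
move=> ux uy; apply: contrapT => xy.
have [|V [V1 Vi VU]] := @nbhs1_mul [set z | z <> (x^-1 * y)%g].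
  by apply: nbhs_neq => /(congr1 (fun z => x * z)%g); rewrite mulg1 mulVKg.
have [N /(_ _ (leq_maxl N _)) NV] := (cvg_seqP _ _).1 (cvg_to1 ux) _ V1.
have [M /(_ _ (leq_maxr _ M)) MV] := (cvg_seqP _ _).1 (cvg_to1 uy) _ V1.
apply: (VU _ _ (NV M) (Vi _ (MV N))).
by rewrite invgM invgK mulgA mulgK.
Qed.

Hypothesis sequential : sequential_space G.

Lemma seq_closed A : (forall u x, (forall n, A (u n)) -> u @ \oo --> x ->
  A x) ->
  closed A.
Proof. by move=> H; apply: sequential => x [u Au]; exact: H. Qed.

Lemma closed_seq A u x : closed A -> (forall n, A (u n)) -> u @ \oo --> x ->
  A x.
Proof.
move=> cA Au /cvg_seqP ux; apply: cA => B /ux[N /(_ N (leqnn N)) BN].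
by exists (u N).
Qed.

Lemma seq_open A : (forall u x, A x -> u @ \oo --> x ->
    exists n, A (u n)) -> open A.
Proof.
move=> H; rewrite -[A]setCK; apply: closed_openC.
apply: seq_closed => u x nA ux Ax.
by have [n /nA] := H _ _ Ax ux.
Qed.

End topological_group.

(** * Strong fans *)

Lemma not_eventually (P : set nat) :
  ~ (exists N, forall n, (N <= n)%N -> P n) -> forall N, exists2 n, (N <= n)%N &
    ~ P n.
Proof.
move=> nP N; apply: contrapT => nex; apply: nP; exists N => n Nn.
by apply: contrapT => nPn; apply: nex; exists n.
Qed.

Lemma injective_unbounded (h : nat -> nat) : injective h ->
  forall N, exists M, forall n, (M <= n)%N -> (N <= h n)%N.
Proof.
move=> hinj; elim=> [|N [M MN]]; first by exists 0.
have [[k hk]|nk] := pselect (exists k, h k = N).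
  exists (maxn M k.+1) => n; rewrite geq_max => /andP[Mn kn].
  rewrite ltn_neqAle MN// andbT; apply/eqP => hn.
  by move: kn; rewrite (hinj k n) ?ltnn// hk.
exists M => n Mn; rewrite ltn_neqAle MN// andbT; apply/eqP => hn.
by apply: nk; exists n.
Qed.

Lemma eventually_all_lt (Q : nat -> nat -> Prop) (n : nat) :
  (forall j, (j < n)%N -> exists N, forall k, (N <= k)%N -> Q j k) ->
  exists N, forall j k, (j < n)%N -> (N <= k)%N -> Q j k.
Proof.
elim: n => [|n IH] H; first by exists 0.
have [j jn|N NP] := IH; first by apply: H; exact: ltnW.
have [M MP] := H n (ltnSn n).
exists (maxn N M) => j k; rewrite ltnS leq_eqVlt geq_max => jn /andP[Nk Mk].
by case/predU1P: jn => [->|jn]; [exact: MP|exact: NP].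
Qed.

Lemma countable_enum (T : Type) (A : set (set T)) : countable A ->
  exists F : nat -> set T, forall B, A B -> exists i, F i = B.
Proof.
move=> /countable_injP[r rinj].
exists (fun i => [set x | exists B, [/\ A B, r B = i & B x]]) => B AB.
exists (r B); apply/seteqP; split=> [x [C [AC rC Cx]]|x Bx]; last by exists B.
by rewrite -(rinj C B) ?inE.
Qed.

Section cs_network.
Variable G : topologicalGroupType.
Implicit Types (x y z : G) (A B U V Z : set G) (u v : nat -> G).
Local Notation "1" := (1%g : G).

Definition cs_star_sequence (F : nat -> set G) := (forall i, closed (F i)) /\
  forall u U, u @ \oo --> 1 -> nbhs 1 U ->
  exists2 i, F i `<=` U & forall N, exists2 n, (N <= n)%N & F i (u n).

Lemma cs_star_sequence_exists : [set: cs_star_character G] #<= [set: nat] ->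
  exists F, cs_star_sequence F.
Proof.
move=> cscnt.
have [|A Acs /card_eqW[AN _]] := @min_size_sat _ (cs_star_network 1) setT.
  move=> U u U1 u1; exists U; split=> //; apply/infinite_natP => N.
  have [M MU] := (cvg_seqP _ _).1 u1 U U1.
  by exists (maxn M N); [exact: leq_maxr|apply: MU; exact: leq_maxl].
have /countable_enum[F FA] : countable A.
  apply: card_le_trans AN (card_le_trans _ cscnt).
  exact: (sup_card_ge (fun x => min_size (cs_star_network x))).
(* By regularity the closures still form a network: a member inside the small [V] has its closure
   inside [U]. *)
exists (closure \o F); split=> [i|u U u1 /nbhs1_closure[V [V1 _ VU]]].
  exact: closed_closure.
have [B [/FA[i FiB] BV /infinite_natP Bu]] := Acs V u V1 u1.
exists i; first by rewrite /= FiB; apply: subset_trans VU; exact: closureS.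
by move=> N; have [n Nn Bn] := Bu N; exists n => //=; apply: subset_closure;
  rewrite FiB.
Qed.

Variable F : nat -> set G.
Hypothesis Fcs : cs_star_sequence F.

Definition finite_union (s : seq nat) : set G := [set x | exists2 i, i \in s &
  F i x].

Definition difference (s : seq nat) : set G :=
  closure [set z | exists a b, [/\ finite_union s a, finite_union s b &
    z = (a^-1 * b)%g]].

Definition inside (U : set G) (n : nat) : seq nat :=
  [seq i <- iota 0 n.+1 | `[< F i `<=` U >]].

Lemma mem_inside U n i : (i \in inside U n) = (i <= n)%N && `[< F i `<=` U >].
Proof. by rewrite mem_filter mem_iota add0n ltnS leq0n andbC. Qed.

Lemma finite_unionS s t : {subset s <= t} -> finite_union s `<=` finite_union t.
Proof. by move=> st x [i /st it Fix]; exists i. Qed.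

Lemma finite_union_inside U n : finite_union (inside U n) `<=` U.
Proof. by move=> x [i]; rewrite mem_inside => /andP[_ /asboolP]; apply. Qed.

Lemma differenceS s t : {subset s <= t} -> difference s `<=` difference t.
Proof.
move=> /finite_unionS st; apply: closureS => z [a [b [sa sb ->]]].
by exists a, b; split=> //; exact: st.
Qed.

Lemma differenceV s x : difference s x -> difference s (x^-1)%g.
Proof.
move=> sx B /nbhs_invg/sx[_ [[a [b [sa sb ->]]] /= Bab]].
exists (a^-1 * b)^-1%g; split=> //; exists b, a; split=> //.
by rewrite invgM invgK.
Qed.

Lemma insideS U m n : (m <= n)%N -> {subset inside U m <= inside U n}.
Proof.
by move=> mn i; rewrite !mem_inside => /andP[im ->]; rewrite (leq_trans im mn).
Qed.

(** Otherwise one picks for each [n] a later term outside all members inside [U] of index at most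
    [n]. Some [F i] inside [U] contains infinitely many of these terms, which is absurd once
    [n >= i]. *)
Lemma cs_eventually u U : u @ \oo --> 1 -> nbhs 1 U ->
  exists m N, forall n, (N <= n)%N -> finite_union (inside U m) (u n).
Proof.
move=> u1 U1; apply: contrapT => nex.
have [h [hP hi]] : exists h : nat -> nat,
    (forall n, ~ finite_union (inside U n) (u (h n))) /\
    (forall m n, (m < n)%N -> (h m < h n)%N).
  apply: (@increasing_sub (fun m n => ~ finite_union (inside U m) (u n))) => m.
  by apply: not_eventually => mN; apply: nex; exists m.
have uh1 : (u \o h) @ \oo --> 1 by apply: cvg_subseq u1; exact: increasing_ge.
have [i FiU /(_ i)[n ni Fin]] := Fcs.2 _ _ uh1 U1.
by apply: (hP n); exists i => //; rewrite mem_inside ni; apply/asboolP.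
Qed.

(** Relative to [Z], so that the dichotomy can also be applied inside each [L n]; for [Z = setT]
    this is a sequential barrier at [1]. *)
Definition barrier_in Z B := forall u, (forall n, Z (u n)) -> u @ \oo --> 1 ->
  exists N, forall n, (N <= n)%N -> B (u n).

(** The condition [j <= h j] makes the selected rows unbounded, so infinitely many rows are met. *)
Definition strong_fan Z (x : nat -> nat -> G) :=
  [/\ forall n k, Z (x n k), forall n, x n @ \oo --> 1 &
   forall (h k : nat -> nat) y, (forall j, (j <= h j)%N) ->
     ~ (fun j => x (h j) (k j)) @ \oo --> y].

Lemma difference_small U : nbhs 1 U -> exists V, [/\ nbhs 1 V, V `<=` U &
  forall s, finite_union s `<=` V -> difference s `<=` U].
Proof.
move=> /nbhs1_closure[W [W1 Wi WU]]; have [V [V1 Vi VW VVW]] := nbhs1_sub W1.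
exists V; split=> //; first by move=> x /VW Wx; apply: WU;
  exact: subset_closure.
move=> s sV; apply: subset_trans WU; apply: closureS => _ [a [b [/sV Va /sV Vb
  ->]]].
by apply: VVW => //; exact: Vi.
Qed.

(* If t i -> y then (t i)^-1 * t j belongs to a fixed D m for large i and j.
   Hence, once sequences S n -> 1 missing D n are pruned so that t^-1 * t' is
   not in D (minn m n) for t in S m and t' in S n with m <> n, no sequence
   meeting infinitely many of them converges. *)
Lemma fan_dichotomy Z :
  (forall U, nbhs 1 U -> exists s, difference s `<=` U /\
    barrier_in Z (difference s)) \/
  exists w, strong_fan Z w.
Proof.
have [|/existsNP[U /not_implyP[U1 nU]]] := pselect (forall U, nbhs 1 U ->
  exists s, difference s `<=` U /\ barrier_in Z (difference s)).
  by left.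
right; have [V [V1 VU sVU]] := difference_small U1.
pose D n := difference (inside V n).
have DU n : D n `<=` U by apply: sVU; exact: finite_union_inside.
have DS m n : (m <= n)%N -> D m `<=` D n by move=> mn; apply: differenceS;
  exact: insideS.
have /choice[S SP] : forall n, exists u, [/\ forall k, Z (u k), u @ \oo -->
  1 & forall k, ~ D n (u k)].
  move=> n; apply: contrapT => nex; apply: nU; exists (inside V n); split;
    first exact: DU.
  move=> u uZ u1; apply: contrapT => /not_eventually/infinite_sub[h [hP hge _]].
  apply: nex; exists (u \o h); split=> // [k|]; first exact: uZ.
  exact: cvg_subseq u1.
have SZ n k : Z (S n k) by have [] := SP n.
have S1 n : S n @ \oo --> 1 by have [] := SP n.
have SD n k : ~ D n (S n k) by have [_ _] := SP n.
(* One point is kept for every code [i] of a pair: it is the term of index [f i] in row [p i].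
   Requiring [f i >= i] keeps the pruned rows convergent to [1]. *)
pose p i : nat := if (unpickle i : option (nat * nat)) is Some nk then nk.1 else
  0.
have pE n k : p (pickle (n, k : nat)) = n by rewrite /p pickleK.
pose P i (f : nat -> nat) k := (i <= k)%N /\ forall j, (j < i)%N ->
  p j <> p i ->
  ~ D (minn (p j) (p i)) ((S (p j) (f j))^-1 * S (p i) k)%g.
have [f fP] : exists f, forall i, P i f (f i).
  apply: (@history_choice _ P 0) => [i f|i f g k fg [ik kP]]; last first.
    by split=> // j ji; rewrite -fg//; exact: kP.
  have [j ji|N NP] := @eventually_all_lt (fun j k => p j <> p i ->
    ~ D (minn (p j) (p i)) ((S (p j) (f j))^-1 * S (p i) k)%g) i; last first.
    by exists (maxn i N); split=> [|j ji]; [exact: leq_maxl|apply: NP => //;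
      exact: leq_maxr].
  (* The inverse of an earlier point misses this closed [D], since [D] is symmetric and increasing
     and row [n] misses [D n]. Multiplied by late terms of a row converging to [1], it still
     does. *)
  have nD : ~ D (minn (p j) (p i)) ((S (p j) (f j))^-1)%g.
    by move=> /differenceV; rewrite invgK => /(DS _ (p j) (geq_minl _ _));
      exact: SD.
  have oD : nbhs ((S (p j) (f j))^-1)%g (~` D (minn (p j) (p i))).
    by apply: open_nbhs_nbhs; split=> //; apply: closed_openC;
      exact: closed_closure.
  have := cvg_lmulg (a := ((S (p j) (f j))^-1)%g) (S1 (p i)); rewrite mulg1.
  by move=> /cvg_seqP/(_ _ oD)[N NP]; exists N => k /NP.
exists (fun n k => S n (f (pickle (n, k)))); split=> [n k//|n|h k y hge ty].
  apply/cvg_seqP => W W1; have [N NW] := (cvg_seqP _ _).1 (S1 n) _ W1.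
  have [|M MN] := @injective_unbounded (fun k => pickle (n, k)) _ N.
    by move=> k k' /(pcan_inj pickleK)[].
  exists M => k Mk; apply: NW; apply: leq_trans (MN k Mk) _.
  by have [] := fP (pickle (n, k)).
pose t j := S (h j) (f (pickle (h j, k j))).
have [m [N mN]] := cs_eventually (cvg_to1 ty) V1.
have tD i j : (maxn m N <= i)%N -> (maxn m N <= j)%N -> D m ((t i)^-1 * t j)%g.
  rewrite !geq_max => /andP[_ Ni] /andP[_ Nj]; apply: subset_closure.
  exists (y^-1 * t i)%g, (y^-1 * t j)%g; split; [exact: mN|exact: mN|].
  by rewrite invgM invgK -mulgA mulVKg.
(* Since [h j >= j > h i], the two points lie in different rows, both of index at least [m]. *)
pose i := maxn m N; pose j := maxn i (h i).+1.
have ij : (h i < h j)%N by apply: leq_trans (hge j); exact: leq_maxr.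
have mi : (m <= minn (h i) (h j))%N.
  by rewrite leq_min !(leq_trans _ (hge _))// /j /i;
    rewrite ?leq_max ?leqnn ?orbT//.
have nt a b : h a <> h b -> (pickle (h a, k a) < pickle (h b, k b))%N ->
    ~ D (minn (h a) (h b)) ((t a)^-1 * t b)%g.
  move=> ab lt; have [_ /(_ _ lt)] := fP (pickle (h b, k b)).
  by rewrite !pE; apply.
have hij : h i <> h j by move=> E; rewrite E ltnn in ij.
have tij : D (minn (h i) (h j)) ((t i)^-1 * t j)%g.
  by apply: DS mi _ _; apply: tD; rewrite ?leqnn// /j leq_maxl.
(* The pruning treats the point with the larger code last; the other order is reduced to this one by
   inverting, [D] being symmetric. *)
have [lt|lt|/(pcan_inj pickleK)[]//] := ltngtP (pickle (h i, k i)) (pickle (h j,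
  k j)).
  exact: nt lt tij.
have /nt := lt; rewrite minnC; apply; first by move=> /esym.
by have := differenceV tij; rewrite invgM invgK.
Qed.

End cs_network.

(** * Countable families of barriers *)

Section barriers.
Variable G : topologicalGroupType.
Implicit Types (x y z : G) (A K U V Z : set G) (u v : nat -> G).
Local Notation "1" := (1%g : G).
Hypothesis T1 : accessible_space G.
Hypothesis sequential : sequential_space G.

Definition barrier_base Z (B : nat -> set G) :=
  [/\ forall n, barrier_in Z (B n),
      forall m n, (m <= n)%N -> B n `<=` B m &
      forall U, nbhs 1 U -> exists n, B n `<=` U].

Lemma barrier_inI Z A V : barrier_in Z A -> barrier_in Z V ->
  barrier_in Z (A `&` V).
Proof.
move=> ZA ZV u uZ u1; have [N NA] := ZA u uZ u1; have [M MV] := ZV u uZ u1.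
by exists (maxn N M) => n; rewrite geq_max => /andP[Nn Mn]; split; auto.
Qed.

(** The [n]-th set is the intersection of those [D i] that are barriers and have code below [n];
    [s n] lists their indices. *)
Lemma barrier_base_exists Z (I : countType) (D : I -> set G) :
  (forall U, nbhs 1 U -> exists i, D i `<=` U /\ barrier_in Z (D i)) ->
  exists B, barrier_base Z B.
Proof.
move=> DU.
pose good i := `[< barrier_in Z (D i) >].
pose s n := pmap (fun k => if unpickle k is Some i then if good i then Some i
  else None else None) (iota 0 n).
have sP n i : i \in s n -> barrier_in Z (D i).
  rewrite mem_pmap => /mapP[k _]; case: unpickle => // j.
  by case: ifP => // /asboolP jZ [->].
have sS m n : (m <= n)%N -> {subset s m <= s n}.
  move=> mn i; rewrite !mem_pmap => /mapP[k km ki]; apply/mapP; exists k => //.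
  by move: km; rewrite !mem_iota !add0n => /leq_trans; apply.
exists (fun n => [set x | forall i, i \in s n -> D i x]).
split=> [n|m n mn x nx i /(sS _ _ mn)/nx //|U /DU[i [DiU iZ]]].
  have H (l : seq I) : (forall i, i \in l -> barrier_in Z (D i)) ->
      barrier_in Z [set x | forall i, i \in l -> D i x].
    elim: l => [|j l IH] lZ; first by move=> u _ _; exists 0.
    have := barrier_inI (lZ j (mem_head _ _)) (IH (fun i il => lZ i (mem_behead
      (s := j :: l) il))).
    move=> jl u uZ u1; have [N NP] := jl u uZ u1; exists N => n' /NP[Dj Dl] i.
    by rewrite in_cons => /predU1P[->|/Dl].
  exact: H (@sP n).
exists (pickle i).+1 => x xs; apply: DiU; apply: xs.
rewrite mem_pmap; apply/mapP; exists (pickle i); first by rewrite mem_iota add0n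
  ltnS leqnn.
by rewrite pickleK /good asboolT.
Qed.

Section barrier_base.
Variables (Z : set G) (B : nat -> set G).
Hypothesis ZB : barrier_base Z B.

Lemma barrier_base_cvg u : (forall n, B n (u n)) -> u @ \oo --> 1.
Proof.
move=> uB; apply/cvg_seqP => U U1; have [_ BS /(_ _ U1)[n nU]] := ZB.
by exists n => m nm; apply: nU; apply: BS nm _ _.
Qed.

Lemma barrier_base_diagonal (w : nat -> nat -> G) : (forall n k, Z (w n k)) ->
  (forall n, w n @ \oo --> 1) ->
  exists k : nat -> nat, (fun n => w n (k n)) @ \oo --> 1.
Proof.
move=> wZ w1; have [bZ _ _] := ZB.
have /choice[k kP] : forall n, exists k, B n (w n k).
  by move=> n; have [N /(_ _ (leqnn N)) NB] := bZ n _ (wZ n) (w1 n); exists N.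
by exists k; exact: barrier_base_cvg.
Qed.

Variable K : set G.
Hypothesis KZ : forall x y, K x -> K y -> Z (x^-1 * y)%g.
Hypothesis Kcl : closed K.

(** If [w n] tends to [u n] and [u] to [x], the quotients [(u n)^-1 * w n k] are sequences in [Z]
    tending to [1]. A diagonal choice [k n] makes them tend to [1] together, so [w n (k n)] tends to
    [x]. *)
Lemma seq_closure_idem A : A `<=` K ->
  seq_closure (seq_closure A) `<=` seq_closure A.
Proof.
move=> AK x [u uA ux].
have /choice[w wP] : forall n, exists v, (forall k, A (v k)) /\ v @ \oo --> u n.
  by move=> n; have [v ? ?] := uA n; exists v.
have uK n : K (u n).
  by have [vA vu] := wP n; apply: closed_seq vu => // k; exact: AK.
have [n k|n|k k1] := @barrier_base_diagonal (fun n k => (u n)^-1 * w n k)%g.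
- by apply: KZ => //; apply: AK; have [] := wP n.
- by rewrite -(mulVg (u n)); apply: cvg_lmulg; have [] := wP n.
- exists (fun n => w n (k n)) => [n|]; first by have [] := wP n.
  have := cvgMg ux k1; rewrite mulg1; apply: cvg_trans; apply: near_eq_cvg.
  by apply: nearW => n; rewrite mulVKg.
Qed.

Lemma closure_seq_closure A : A `<=` K -> closure A `<=` seq_closure A.
Proof.
move=> AK; have cl : closed (seq_closure A) by apply: sequential;
  exact: seq_closure_idem.
by rewrite [X in _ `<=` X](closure_id _).1//; apply: closureS;
  exact: seq_closure_sub.
Qed.

(** If [1] were in the closure of [K] minus [A], one sequence from that set would converge to [1],
    against the barrier property. *)
Lemma barrier_in_nbhs A : barrier_in K A ->
  exists V, [/\ nbhs 1 V, open V & forall x, V x -> K x -> A x].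
Proof.
move=> AK; exists (~` closure (K `\` A)).
have oV : open (~` closure (K `\` A)) by apply: closed_openC;
  exact: closed_closure.
split=> //; last first.
  by move=> x Vx Kx; apply: contrapT => nAx; apply: Vx; apply: subset_closure.
apply: open_nbhs_nbhs; split=> // /closure_seq_closure[|u uKA u1].
  by move=> x [].
have [N /(_ N (leqnn N)) NA] : exists N, forall n, (N <= n)%N -> A (u n).
  by apply: AK u1 => n; have [] := uKA n.
by have [_] := uKA N.
Qed.

End barrier_base.

Lemma first_countable_of_barriers (B : nat -> set G) : barrier_base setT B ->
  exists V : nat -> set G, [/\ forall n, nbhs 1 (V n) &
    forall U, nbhs 1 U -> exists n, V n `<=` U].
Proof.
move=> Bb; have [bB BS BU] := Bb.
have /choice[V VP] : forall n, exists V, nbhs 1 V /\ V `<=` B n.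
  move=> n; have [//||V [V1 _ VB]] := barrier_in_nbhs Bb _ _ (bB n).
    exact: closedT.
  by exists V; split=> // x Vx; exact: VB.
exists V; split=> [n|U /BU[n nU]]; first by have [] := VP n.
by exists n; have [_ VB] := VP n; exact: subset_trans nU.
Qed.

Lemma sequential_order1_of_barriers (B : nat -> set G) : barrier_base setT B ->
  ord_eq (sequential_order G) ordinal1.
Proof.
move=> Bb; apply: sequential_order1 => A.
by apply: (seq_closure_idem Bb (K := setT)) => //; exact: closedT.
Qed.

End barriers.

(** * Sequentially compact sets *)

(** Meant for the indices of a sequence of points: an indexed set is shown to be sequentially closed
    by separating unbounded from constant indices along a subsequence. *)
Lemma unbounded_or_constant (a : nat -> nat) :
  exists h : nat -> nat, (forall j, (j <= h j)%N) /\
   ((forall j, (j <= a (h j))%N) \/ exists c, forall j, a (h j) = c).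
Proof.
have [[c ac]|nc] := pselect (exists c, forall N, exists2 n, (N <= n)%N &
  a n = c).
  have [h [hc hge _]] := @infinite_sub (fun n => a n = c) ac.
  by exists h; split=> //; right; exists c.
have /choice[h hP] : forall j, exists n, (j <= n)%N /\ (j <= a n)%N.
  move=> j; apply: contrapT => nex; apply: nc.
  have aj n : (j <= n)%N -> (a n < j)%N.
    by move=> jn; rewrite ltnNge; apply/negP => ja; apply: nex; exists n.
  apply: contrapT => /forallNP nc.
  have [i ij|N NP] := @eventually_all_lt (fun c n => a n <> c) j.
    have /existsNP[N nN] := nc i; exists N => k Nk aki; apply: nN; by exists k.
  exact: (NP (a (maxn j N)) (maxn j N) (aj _ (leq_maxl _ _)) (leq_maxr _ _)).
by exists h; split=> [j|]; [|left=> j]; have [] := hP j.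
Qed.

Section sequentially_compact.
Variable G : topologicalGroupType.
Implicit Types (x y z : G) (A K L U V Z : set G) (u v : nat -> G).
Local Notation "1" := (1%g : G).
Hypothesis T1 : accessible_space G.
Hypothesis sequential : sequential_space G.

Definition seq_compact K := forall u, (forall n, K (u n)) ->
  exists (h : nat -> nat) y, (forall j, (j <= h j)%N) /\ (u \o h) @ \oo --> y.

Lemma seq_compactU K L : seq_compact K -> seq_compact L ->
  seq_compact (K `|` L).
Proof.
move=> Kc Lc u uKL.
have [Kinf|] := pselect (forall N, exists2 n, (N <= n)%N & K (u n)).
  have [h [hK hge _]] := @infinite_sub (fun n => K (u n)) Kinf.
  have [h' [y [h'ge uy]]] := Kc _ hK.
  by exists (h \o h'), y; split=> // j; apply: leq_trans (h'ge j) (hge _).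
move=> /existsNP[N nN].
have Lu j : L ((fun j => u (maxn j N)) j).
  by case: (uKL (maxn j N)) => // Kj; case: nN; exists (maxn j N) => //;
    exact: leq_maxr.
have [h [y [hge uy]]] := Lc _ Lu.
exists (fun j => maxn (h j) N), y; split=> // j.
by apply: leq_trans (hge j) _; exact: leq_maxl.
Qed.

Lemma seq_compact1 : seq_compact [set 1].
Proof.
move=> u u1; exists id, 1; split=> //; have -> : u \o id = fun=> 1.
  by apply/funext => n; exact: u1.
exact: cvg_cst.
Qed.

Definition quotient_set K : set G := [set z | exists a b, [/\ K a, K b &
  z = (a * b^-1)%g]].

Lemma quotient_set_lim K u : closed K -> seq_compact K -> (forall n,
  quotient_set K (u n)) ->
  exists (h : nat -> nat) y, [/\ forall j, (j <= h j)%N, (u \o h) @ \oo -->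
    y & quotient_set K y].
Proof.
move=> Kcl Kc uK.
have /choice[ab abP] : forall n, exists p : G * G, [/\ K p.1, K p.2 &
  u n = (p.1 * p.2^-1)%g].
  by move=> n; have [a [b ?]] := uK n; exists (a, b).
have [n|h [a [hge ha]]] := Kc (fun n => (ab n).1); first by have [] := abP n.
have [n|h' [b [h'ge hb]]] := Kc (fun n => (ab (h n)).2); first by have [] :=
  abP (h n).
exists (h \o h'), (a * b^-1)%g; split.
- by move=> j; apply: leq_trans (h'ge j) (hge _).
- have -> : u \o (h \o h') = fun n => ((ab (h (h' n))).1 * ((ab (h (h'
    n))).2)^-1)%g.
    by apply/funext => n /=; have [] := abP (h (h' n)).
  by apply: cvgMg (cvg_subseq h'ge ha) (cvgVg hb).
- exists a, b; split=> //.
    by apply: closed_seq Kcl _ ha => n; have [] := abP (h n).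
  by apply: closed_seq Kcl _ hb => n; have [] := abP (h (h' n)).
Qed.

Lemma seq_compact_quotient K : closed K -> seq_compact K ->
  seq_compact (quotient_set K).
Proof.
move=> Kcl Kc u /(quotient_set_lim Kcl Kc)[h [y [? ? _]]].
by exists h, y.
Qed.

Lemma closed_quotient K : closed K -> seq_compact K -> closed (quotient_set K).
Proof.
move=> Kcl Kc; apply: seq_closed => // u x uK ux.
have [h [y [hge uy Ky]]] := quotient_set_lim Kcl Kc uK.
by rewrite (cvg_uniq T1 (cvg_subseq hge ux) uy).
Qed.

(** The first points of the rows would have a convergent subsequence, which meets infinitely many
    rows. *)
Lemma seq_compact_no_fan K w : seq_compact K -> ~ strong_fan K w.
Proof.
move=> Kc [wK w1 nw].
have [n|h [y [hge wy]]] := Kc (fun n => w n 0); first exact: wK.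
exact: (nw h (fun=> 0) y hge wy).
Qed.

Variable F : nat -> set G.
Hypothesis Fcs : cs_star_sequence F.

(** Finite intersections of finite unions of the [F i]: a countable family, coded by lists of
    lists. *)
Definition block (t : seq (seq nat)) : set G :=
  [set x | forall s, s \in t -> finite_union F s x].

Lemma closed_finite_union s : closed (finite_union F s).
Proof.
elim: s => [|i s IH].
  by rewrite (_ : finite_union _ _ = set0); [exact: closed0|apply/seteqP;
    split=> x // []].
rewrite (_ : finite_union _ _ = F i `|` finite_union F s);
  first by apply: closedU IH; exact: Fcs.1.
apply/seteqP; split=> x [].
- by move=> j; rewrite in_cons => /predU1P[->|js] ?; [left|right; exists j].
- by move=> Fix; exists i => //; exact: mem_head.
- by move=> [j js ?]; exists j => //; rewrite in_cons js orbT.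
Qed.

Lemma closed_block t : closed (block t).
Proof.
rewrite (_ : block t = \bigcap_(s in [set` t]) finite_union F s); last by [].
by apply: closed_bigI => s _; exact: closed_finite_union.
Qed.

Variable w : nat -> nat -> G.
Hypothesis wfan : strong_fan setT w.

(* Otherwise the products y n k * w n k, for k large, form a closed set that
   misses 1 but meets every neighborhood of 1. *)
Lemma fan_not_metric (M : nat -> set G) (y : nat -> nat -> G) :
  (forall U, nbhs 1 U -> exists N, forall n, (N <= n)%N -> M n `<=` U) ->
  (forall n k, M n (y n k)) ->
  exists n h z, (forall j, (j <= h j)%N) /\ (y n \o h) @ \oo --> z.
Proof.
move=> MU yM; apply: contrapT => nconv.
have ny n h z : (forall j, (j <= h j)%N) -> ~ (y n \o h) @ \oo --> z.
  by move=> hge yz; apply: nconv; exists n, h, z.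
have [_ w1 nw] := wfan.
have wV n : (fun k => (w n k)^-1)%g @ \oo --> 1.
  by rewrite -(invg1 G); exact: cvgVg.
have /choice[f fP] : forall n, exists N, forall k, (N <= k)%N ->
  (y n k * w n k)%g <> 1.
  move=> n; apply: contrapT => /not_eventually/infinite_sub[h [hP hge _]].
  apply: (ny n h 1 hge); have := cvg_subseq hge (wV n).
  apply: cvg_trans; apply: near_eq_cvg; apply: nearW => j /=.
  by have /contrapT/mulg1_eq <- := hP j; rewrite invgK.
(* Indices below [f n] are dropped so that [1] is not in [P]. *)
pose P := [set x | exists n k, (f n <= k)%N /\ x = (y n k * w n k)%g].
have Pcl : closed P.
  apply: seq_closed => // p x /choice[n /choice[k nkP]] px.
  have [h [hge hn]] := unbounded_or_constant n.
  have [h' [h'ge hk]] := unbounded_or_constant (k \o h).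
  pose g := h \o h'; have gge j : (j <= g j)%N by apply: leq_trans (h'ge j) (hge
    _).
  have pg : p \o g @ \oo --> x by exact: cvg_subseq px.
  have pE j : p (g j) = (y (n (g j)) (k (g j)) * w (n (g j)) (k (g j)))%g.
    by have [] := nkP (g j).
  (* In unbounded rows [y] tends to [1]; dividing by it would make points of the fan in unbounded
     rows converge. *)
  case: hn => [hn|[m hn]].
    have gn j : (j <= n (g j))%N by apply: leq_trans (h'ge j) (hn _).
    have yg : (fun j => y (n (g j)) (k (g j))) @ \oo --> 1.
      apply/cvg_seqP => U /MU[N NU]; exists N => j Nj.
      by apply: NU (yM _ _); exact: leq_trans (gn j).
    case: (nw (n \o g) (k \o g) x gn).
    have := cvgMg (cvgVg yg) pg; rewrite invg1 mul1g.
    apply: cvg_trans; apply: near_eq_cvg; apply: nearW => j /=.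
    by rewrite pE mulKg.
  have gn j : n (g j) = m by exact: hn.
  (* In a single row with unbounded columns [w] tends to [1], so the row [y m] would have a
     convergent subsequence. If the column is constant too, so is the sequence. *)
  case: hk => [hk|[c hk]].
    have gk j : (j <= k (g j))%N by exact: hk.
    case: (ny m (k \o g) x gk).
    have := cvgMg pg (cvg_subseq gk (wV m)); rewrite mulg1.
    apply: cvg_trans; apply: near_eq_cvg; apply: nearW => j /=.
    by rewrite pE gn mulgK.
  have gc j : k (g j) = c by exact: hk.
  have -> : x = p (g 0).
    apply: (@cvg_uniq _ T1 _ _ _ pg).
    have -> : p \o g = fun=> p (g 0) by apply/funext => j /=;
      rewrite !pE !gn !gc.
    exact: cvg_cst.
  by exists (n (g 0)), (k (g 0)); have [] := nkP (g 0).
have P1 : nbhs 1 (~` P).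
  apply: open_nbhs_nbhs; split; first exact: closed_openC.
  by move=> [n [k [/fP fk /esym]]].
have [V [V1 _ VP]] := nbhs1_mul P1.
have [N /(_ N (leqnn N)) NV] := MU _ V1.
have [K KV] := (cvg_seqP _ _).1 (w1 N) _ V1.
apply: (VP (y N (maxn K (f N))) (w N (maxn K (f N)))).
- exact: NV.
- by apply: KV; exact: leq_maxl.
- by exists N, (maxn K (f N)); rewrite leq_maxr.
Qed.

(** Otherwise intersect the first [n] finite unions that eventually contain [u]. These blocks shrink
    to [1] by [cs_eventually], and each contains a sequence without convergent subsequence, which
    [fan_not_metric] forbids. *)
Lemma seq_compact_block u : u @ \oo --> 1 ->
  exists t, seq_compact (block t) /\ exists N, forall n, (N <= n)%N ->
    block t (u n).
Proof.
move=> u1; apply: contrapT => nex.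
pose good s := `[< exists N, forall n, (N <= n)%N -> finite_union F s (u n) >].
pose t n := pmap (fun k => if unpickle k is Some s then if good s then Some s
  else None else None) (iota 0 n).
have tP n s : s \in t n -> good s.
  rewrite mem_pmap => /mapP[k _]; case: unpickle => // j.
  by case: ifP => // jg [->].
have tmem n s : (pickle s < n)%N -> good s -> s \in t n.
  move=> sn gs; rewrite mem_pmap; apply/mapP; exists (pickle s).
    by rewrite mem_iota add0n.
  by rewrite pickleK gs.
have ut (l : seq (seq nat)) : (forall s, s \in l -> good s) ->
    exists N, forall n, (N <= n)%N -> block l (u n).
  elim: l => [|s l IH] lg; first by exists 0.
  have [i il|N NP] := IH; first by apply: lg; rewrite in_cons il orbT.
  have /asboolP[M MP] := lg s (mem_head _ _).
  exists (maxn N M) => n; rewrite geq_max => /andP[Nn Mn] s'.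
  by rewrite in_cons => /predU1P[->|s'l]; [exact: MP|exact: NP].
have tgood n : exists N, forall k, (N <= k)%N -> block (t n) (u k) by apply: ut;
  exact: tP.
have /choice[y yP] : forall n, exists v, (forall k, block (t n) (v k)) /\
    forall h z, (forall j, (j <= h j)%N) -> ~ (v \o h) @ \oo --> z.
  move=> n; apply: contrapT => nv; apply: nex; exists (t n); split=> // v vt.
  apply: contrapT => nh; apply: nv; exists v; split=> // h z hge vz.
  by apply: nh; exists h, z.
have [U U1|n k|n [h [z [hge yz]]]] := @fan_not_metric (fun n => block (t n)) y.
- have [m [N mN]] := cs_eventually Fcs u1 U1.
  pose s := inside F U m; have gs : good s by apply/asboolP; exists N.
  exists (pickle s).+1 => n sn x /(_ s (tmem _ _ sn gs)).
  exact: finite_union_inside.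
- by have [] := yP n.
- by have [_ /(_ h z hge)] := yP n.
Qed.

Definition tower (L : nat -> set G) :=
  [/\ forall n, L n 1,
      forall m n, (m <= n)%N -> L m `<=` L n,
      forall n x y, L n x -> L n y -> L n.+1 (x * y^-1)%g,
      forall n, closed (L n) /\ seq_compact (L n) &
      forall u, u @ \oo --> 1 -> exists m N, forall n, (N <= n)%N -> L m (u n)].

Lemma tower_exists : exists L : nat -> set G, tower L.
Proof.
(* [C] enumerates the sequentially compact blocks; all other codes get the empty set, so every [C n]
   is closed and sequentially compact. *)
pose C n := if (unpickle n : option (seq (seq nat))) is Some t
  then if `[< seq_compact (block t) >] then block t else set0 else set0.
have Ccl n : closed (C n).
  rewrite /C; case: unpickle => [t|]; last exact: closed0.
  by case: ifP => _; [exact: closed_block|exact: closed0].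
have Cc n : seq_compact (C n).
  rewrite /C; case: unpickle => [t|u /(_ 0)//].
  by case: ifP => [/asboolP //|_ u /(_ 0)].
pose L := fix L n := if n is m.+1 then quotient_set (L m `|` C m) else [set 1].
have L1 n : L n 1.
  by elim: n => //= n IH; exists 1, 1; split; [left|left|rewrite mulgV].
have LS n x : L n x -> L n.+1 x.
  by move=> nx; exists x, 1; split; [left|left; exact: L1|rewrite divg1].
have Lmono m n : (m <= n)%N -> L m `<=` L n.
  move=> /subnK <-; elim: (n - m)%N => // k IH x /IH; exact: LS.
have Lcc n : closed (L n) /\ seq_compact (L n).
  elim: n => [|n [Lcl Lc]].
    by split; [exact: accessible_closed_set1|exact: seq_compact1].
  have Ucl : closed (L n `|` C n) by exact: closedU.
  have Uc : seq_compact (L n `|` C n) by exact: seq_compactU.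
  by split; [exact: closed_quotient|exact: seq_compact_quotient].
exists L; split=> // [n x y nx ny|u /seq_compact_block[t [tc [N tN]]]].
  by exists x, y; split; [left|left|].
exists (pickle t).+1, N => n /tN tn; exists (u n), 1; split.
- by right; rewrite /C pickleK asboolT.
- by left; exact: L1.
- by rewrite divg1.
Qed.

End sequentially_compact.

(** * The case of a strong fan *)

Section tower.
Variable G : topologicalGroupType.
Implicit Types (x y z : G) (A K U V Z : set G) (u v : nat -> G).
Local Notation "1" := (1%g : G).
Hypothesis T1 : accessible_space G.
Hypothesis sequential : sequential_space G.
Variable F : nat -> set G.
Hypothesis Fcs : cs_star_sequence F.
Variable L : nat -> set G.
Hypothesis Ltower : tower L.

Lemma tower1 n : L n 1.
Proof. by case: Ltower. Qed.

Lemma towerS m n : (m <= n)%N -> L m `<=` L n.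
Proof. by case: Ltower => _ H *; exact: H. Qed.

Lemma towerF n x y : L n x -> L n y -> L n.+1 (x * y^-1)%g.
Proof. by case: Ltower => _ _ H *; exact: H. Qed.

Lemma towerV n x : L n x -> L n.+1 (x^-1)%g.
Proof. by move=> nx; rewrite -[(x^-1)%g]mul1g; apply: towerF => //;
  exact: tower1. Qed.

Lemma towerM n x y : L n x -> L n y -> L n.+2 (x * y)%g.
Proof.
move=> nx /towerV ny; rewrite -[y]invgK; apply: towerF => //.
exact: towerS nx.
Qed.

Lemma towerVM n x y : L n x -> L n y -> L n.+3 (x^-1 * y)%g.
Proof. by move=> /towerV nx ny; apply: towerM => //; exact: towerS ny. Qed.

Lemma tower_closed n : closed (L n).
Proof. by case: Ltower => _ _ _ H _; have [] := H n. Qed.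

Lemma tower_seq_compact n : seq_compact (L n).
Proof. by case: Ltower => _ _ _ H _; have [] := H n. Qed.

Lemma tower_cvg m u x : L m x -> u @ \oo --> x ->
  exists k N, forall n, (N <= n)%N -> L k (u n).
Proof.
move=> mx ux; have [_ _ _ _ /(_ _ (cvg_to1 ux))[k [N kN]]] := Ltower.
exists (maxn m k).+2, N => n /kN kn.
rewrite -(mulVKg x (u n)); apply: towerM.
  exact: towerS (leq_maxl _ _) _ mx.
exact: towerS (leq_maxr _ _) _ kn.
Qed.

Lemma tower_difference n U : nbhs 1 U ->
  exists s, difference F s `<=` U /\ barrier_in (L n) (difference F s).
Proof.
have [H|[w wfan]] := fan_dichotomy Fcs (L n); first exact: H.
by case: (seq_compact_no_fan (@tower_seq_compact n) wfan).
Qed.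

Lemma tower_barrier_base n : exists B, barrier_base (L n) B.
Proof. exact/barrier_base_exists/tower_difference. Qed.

Lemma tower_nbhs n A : barrier_in (L n) A ->
  exists V, [/\ nbhs 1 V, open V & forall x, V x -> L n x -> A x].
Proof.
(* Level [n.+3] contains the quotients of points of [L n]. *)
have [B Bb] := tower_barrier_base n.+3.
apply: (barrier_in_nbhs sequential Bb) => [x y|].
  exact: towerVM.
exact: tower_closed.
Qed.

Definition tower_group : set G := \bigcup_n L n.

Lemma tower_groupVM x y : tower_group x -> tower_group y ->
  tower_group (x^-1 * y)%g.
Proof.
move=> [m _ mx] [n _ ny]; exists (maxn m n).+3 => //; apply: towerVM.
  exact: towerS (leq_maxl _ _) _ mx.
exact: towerS (leq_maxr _ _) _ ny.
Qed.

Lemma tower_group1 : tower_group 1.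
Proof. by exists 0 => //; exact: tower1. Qed.

Lemma tower_groupM x y : tower_group x -> tower_group y ->
  tower_group (x * y)%g.
Proof.
move=> Hx Hy; rewrite -[x]invgK; apply: tower_groupVM => //.
by rewrite -[(x^-1)%g]mulg1; apply: tower_groupVM => //; exact: tower_group1.
Qed.

Lemma open_tower_group : open tower_group.
Proof.
apply: seq_open => // u x [m _ mx] /(tower_cvg mx)[k [N /(_ N (leqnn N)) kN]].
by exists N, k.
Qed.

(** An open subgroup is closed: for some [N] both [u N] and [x^-1 * u N] lie in it. *)
Lemma tower_group_cvg u x : (forall n, tower_group (u n)) -> u @ \oo --> x ->
  tower_group x.
Proof.
move=> uH /cvg_to1 u1; have /cvg_seqP/(_ tower_group)[|N /(_ N (leqnn N))] :=
  u1.
  by apply: open_nbhs_nbhs; split; [exact: open_tower_group|exact: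
    tower_group1].
move=> HN; rewrite -[x]invgK -[(x^-1)%g](mulgK (u N)) invgM invgK.
rewrite -[X in tower_group (X * _)%g]invgK; apply: tower_groupVM.
  by rewrite -[(u N)^-1%g]mulg1; apply: tower_groupVM => //;
    exact: tower_group1.
by rewrite -[((_)^-1)%g]mulg1; apply: tower_groupVM => //; exact: tower_group1.
Qed.

(** A point of [L n] other than [1] is excluded by a neighborhood whose trace on [L n] lies in a
    small barrier; a point outside the subgroup is excluded by the subgroup, coded by [None]. *)
Lemma tower_points : exists W : nat -> set G,
  (forall n, open (W n) /\ W n 1) /\ forall x, x <> 1 -> exists n, ~ W n x.
Proof.
have [B BP] := choice tower_barrier_base.
have /choice[V VP] : forall nk : nat * nat, exists V, [/\ open V, V 1 &
    forall x, V x -> L nk.1 x -> B nk.1 nk.2 x].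
  move=> [n k]; have [bB _ _] := BP n.
  have [V [V1 oV VB]] := tower_nbhs (bB k).
  by exists V; split=> //; exact: nbhs_singleton.
exists (fun i => if (unpickle i : option (option (nat * nat))) is Some (Some nk)
  then V nk else tower_group).
split=> [i|x x1].
  case: unpickle => [[nk|]|]; first by have [] := VP nk.
    by split; [exact: open_tower_group|exact: tower_group1].
  by split; [exact: open_tower_group|exact: tower_group1].
have [[n _ nx]|nHx] := pselect (tower_group x).
  have [_ _ /(_ _ (nbhs_neq T1 (nesym x1)))[k kx]] := BP n.
  exists (pickle (Some (n, k))); rewrite pickleK => Vx.
  by have [_ _ /(_ _ Vx nx)/kx] := VP (n, k).
by exists (pickle (None : option (nat * nat))); rewrite pickleK.
Qed.

(** The value [f n] selects a barrier relative to [L n]. The union of the selected traces is a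
    barrier, since a sequence converging to [1] is eventually in one [L m]. *)
Lemma tower_barriers : exists B : (nat -> nat) -> set G,
  [/\ forall f, barrier_in setT (B f), forall f, B f 1,
      forall f g, (forall n, (f n <= g n)%N) -> B g `<=` B f &
      forall U, nbhs 1 U -> exists f, B f `<=` U].
Proof.
have [B BP] := choice tower_barrier_base.
have B1 n k : B n k 1.
  have [bB _ _] := BP n; have [|//|N /(_ N (leqnn N))//] := bB k (fun=> 1).
    by move=> _; exact: tower1.
  exact: cvg_cst.
exists (fun f => \bigcup_n (L n `&` B n (f n))); split=> [f u _ u1|f|f g fg x [n
  _ [nx gx]]|U U1].
- have [_ _ _ _ /(_ _ u1)[m [N mN]]] := Ltower.
  have [bB _ _] := BP m; have [|k|M MB] := bB (f m) (fun k => u (maxn N k)).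
  + by move=> k; apply: mN; exact: leq_maxl.
  + by apply: (@cvg_subseq _ u 1 (maxn N)) => // j; exact: leq_maxr.
  + exists (maxn N M) => n; rewrite geq_max => /andP[Nn Mn]; exists m => //;
      split; first exact: mN.
    by have := MB _ Mn; rewrite (maxn_idPr Nn).
- by exists 0 => //; split; [exact: tower1|exact: B1].
- by exists n => //; split=> //; have [_ BS _] := BP n; exact: BS (fg n) _ gx.
- have /choice[f fP] : forall n, exists k, B n k `<=` U by move=> n;
    have [_ _] := BP n; apply.
  by exists f => x [n _ [_ /fP]].
Qed.

(* A union of products of barriers B (f 0) * ... * B (f n) over all n is
   sequentially open; one function f codes the whole sequence of functions. *)
Lemma tower_neighborhoods : exists W : (nat -> nat) -> set G,
  [/\ forall f, open (W f) /\ W f 1,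
      forall f g, (forall n, (f n <= g n)%N) -> W g `<=` W f &
      forall U, nbhs 1 U -> exists f, W f `<=` U].
Proof.
have [B [bB B1 BS BU]] := tower_barriers.
(* [row g i] is the [i]-th of the functions coded by [g]. *)
pose row (g : nat -> nat) (i n : nat) : nat := g (pickle (i, n)).
pose W := fix W (g : nat -> nat) (n : nat) : set G := if n is m.+1
  then [set z | exists x y, [/\ W g m x, B (row g m) y & z = (x * y)%g]] else
    [set 1].
have W1 g n : W g n 1.
  by elim: n => //= n IH; exists 1, 1; split=> //; rewrite mulg1.
exists (fun g => \bigcup_n W g n); split=> [g|f g fg x [n _ nx]|U U1].
- split; last by exists 0.
  apply: seq_open => // u x [n _ nx] /cvg_to1 xu.
  have [//|N /(_ N (leqnn N)) NB] := bB (row g n) _ _ xu.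
  by exists N, n.+1 => //; exists x, (x^-1 * u N)%g; split=> //; rewrite mulVKg.
- exists n => //; elim: n x nx => // n IH _ [x [y [/IH nx yB ->]]].
  exists x, y; split=> //; apply: BS yB => k; exact: fg.
- have /choice[h hP] : forall V : set G, exists V' : set G, nbhs 1 V ->
    nbhs 1 V' /\
      forall a b, V' a -> V' b -> V (a * b)%g.
    move=> V; have [V1|nV1] := pselect (nbhs 1 V); last by exists V.
    by have [V' [V'1 _ V'V]] := nbhs1_mul V1; exists V'.
  (* Products of two elements of [V n.+1] lie in [V n], and the [n]-th barrier is put inside
     [V n.+1]; hence all finite products stay in [U]. *)
  pose V n := iter n h U.
  have V1 n : nbhs 1 (V n) by elim: n => //= n IH; exact: (hP _ IH).1.
  have /choice[f fP] : forall n, exists f, B f `<=` V n.+1 by move=> n;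
    exact: BU.
  pose g i := if (unpickle i : option (nat * nat)) is Some nk then f nk.1 nk.2
    else 0.
  have rowg n : row g n = f n by apply/funext => k; rewrite /row /g pickleK.
  have WV n x y : W g n x -> V n y -> U (x * y)%g.
    elim: n x y => [x y -> Vy|n IH _ y [x [b [Wx Bb ->]]] Vy];
      first by rewrite mul1g.
    rewrite -mulgA; apply: IH Wx _; apply: (hP _ (V1 n)).2 => //.
    by apply: fP; rewrite -rowg.
  exists g => x [n _ nx]; rewrite -[x]mulg1; apply: WV nx _.
  exact: nbhs_singleton (V1 n).
Qed.

(** * Sequential order in the presence of a strong fan *)

Section fan.
Variable w : nat -> nat -> G.
Hypothesis wfan : strong_fan setT w.

(** If [L m] were a barrier, it would contain a point from each row of the fan, and these would have
    a convergent subsequence. *)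
Lemma tower_escape m : exists u, u @ \oo --> 1 /\ forall n, ~ L m (u n).
Proof.
apply: contrapT => nex; have [_ w1 nw] := wfan.
have bL : barrier_in setT (L m).
  move=> u _ u1; apply: contrapT => /not_eventually/infinite_sub[h [hP hge _]].
  by apply: nex; exists (u \o h); split=> //; exact: cvg_subseq u1.
have /choice[k kP] : forall n, exists k, L m (w n k).
  by move=> n; have [//|N /(_ N (leqnn N)) NL] := bL _ _ (w1 n); exists N.
have [h [y [hge wy]]] := tower_seq_compact kP.
exact: (nw h (k \o h) y hge wy).
Qed.

Section gap.
Variable b : wellorder.

Definition opt_lt (x : option b) (s : b) := if x is Some t then wo_lt t s else
  True.

(* The point 1 enters the iterated sequential closures of A exactly at stage
   t + 1, where None stands for stage -1: C s is an upper bound for the stages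
   up to s. All stages avoid L m except for the point 1, so that translates of
   different such sets can be kept apart. *)
Definition gap (t : option b) (m : nat) := exists (A : set G) (C : b -> set G),
  [/\ (forall s, A `<=` C s) /\ (forall s, C s `<=` tower_group),
      forall s s', wo_lt s s' -> seq_closure (C s) `<=` C s',
      forall s, ~ opt_lt t s -> ~ C s 1,
      forall s x, C s x -> L m x -> x = 1 &
      if t is Some t' then seq_iter A (ord_succ (wo_below t')) 1 else A 1].

Lemma gap_None m : gap None m.
Proof.
exists [set 1], (fun=> [set 1]); split=> //.
- by split=> [s x //|s x ->]; exact: tower_group1.
- move=> s s' _ x [u u1 ux]. apply: (cvg_uniq T1 ux).
  have -> : u = fun=> 1 by apply/funext => n; exact: u1.
  exact: cvg_cst.
- by move=> s; case.
Qed.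

Hypothesis bcnt : countable [set: b].

(** Running maxima of an enumeration of the predecessors of [t], starting from the bottom [None]; if
    [t] is minimal, every [r n] is [None]. *)
Lemma cofinal_below (t : b) : exists r : nat -> option b,
  (forall n, opt_lt (r n) t) /\
  forall s, wo_lt s t -> exists N, forall n, (N <= n)%N -> ~ opt_lt (r n) s.
Proof.
have /countable_injP[c cinj] := bcnt.
pose mx (x y : option b) := if x is Some a then
  (if y is Some d then (if pselect (wo_lt a d) then y else x) else x) else y.
pose e i : option b := if pselect (exists s, wo_lt s t /\ c s = i) is left h
  then Some (sval (cid h)) else None.
have et i : opt_lt (e i) t.
  by rewrite /e; case: pselect => //= h; case: cid => /= s [].
have eE s : wo_lt s t -> e (c s) = Some s.
  move=> st; rewrite /e; case: pselect => [h|[]]; last by exists s.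
  by case: cid => /= s' [_ /cinj -> //]; rewrite inE.
pose r := fix r n := if n is m.+1 then mx (r m) (e m) else None.
have mxl (x y : option b) (s : b) : opt_lt (mx x y) s -> opt_lt x s.
  case: x y => [x|//] [y|//] /=; case: pselect => //= xy; exact: wo_trans.
have mxr (x y : option b) (s : b) : opt_lt (mx x y) s -> opt_lt y s.
  case: x y => [x|//] [y|//] //=; case: pselect => //= xy xs.
  by have [->//|yx] := wo_nlt xy; exact: wo_trans xs.
exists r; split.
  elim=> //= n IH; move: (et n) IH; case: (r n) (e n) => [x|] [y|] //=.
  by case: pselect.
move=> s st; exists (c s).+1 => n; elim: n => // n IH.
rewrite ltnS leq_eqVlt => /predU1P[<- /mxr|sn /mxl]; last exact: IH.
by rewrite eE //= => /wo_irr.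
Qed.

(* Glue the translates by v n -> 1 of gaps of ranks r n cofinal below t. The
   n-th translate avoids L n except for v n, so a sequence meeting infinitely
   many of them off the points v n does not converge. *)
Lemma gapP (t : option b) m : gap t m.
Proof.
case: t m => [t|]; last exact: gap_None.
elim/(well_founded_ind (@wo_wf b)): t => t IH m.
have {}IH (x : option b) l : opt_lt x t -> gap x l.
  by case: x => [s /IH|_]; [exact|exact: gap_None].
have [r [rt rcof]] := cofinal_below t.
have [v [p [v1 vm vp]]] : exists v p, [/\ v @ \oo --> 1, forall n, ~ L m (v n) &
    forall n, L p (v n)].
  have [v [v1 vm]] := tower_escape m.
  have [_ _ _ _ /(_ _ v1)[p [N vp]]] := Ltower.
  exists (fun n => v (maxn N n)), p; split=> // [|n]; last by apply: vp;
    exact: leq_maxl.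
  by apply: (@cvg_subseq _ v 1 (maxn N)) => // j; exact: leq_maxr.
(* If [v n] is in [L p] and [v n * y] in [L (maxn n m)], then [y] is their quotient; the three extra
   levels make room for it. *)
pose l n := (maxn p (maxn n m)).+3.
have vL n y : L (maxn n m) (v n * y)%g -> L (l n) y.
  move=> nvy; rewrite -(mulKg (v n) y); apply: towerVM.
    exact: towerS (leq_maxl _ _) _ (vp n).
  exact: towerS (leq_maxr _ _) _ nvy.
have vLm n y : L m (v n * y)%g -> L (l n) y.
  by move=> my; apply: vL; exact: towerS (leq_maxr _ _) _ my.
have /choice[A /choice[C AC]] := fun n => IH (r n) (l n) (rt n).
pose A' : set G := [set x | exists n y, A n y /\ x = (v n * y)%g].
(* The point [1] is the limit of the [v n] and is added only to the bounds for stages after [t]. *)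
pose C' s : set G := [set x | (exists n y, C n s y /\ x = (v n * y)%g) \/
  (wo_lt t s /\ x = 1)].
have C'L s x : C' s x -> L m x -> x = 1.
  move=> [[n [y [ny ->]]] mx|[]//]; have [_ _ _ CL _] := AC n.
  have y1 := CL _ _ ny (vLm _ _ mx).
  by move: mx; rewrite y1 mulg1 => /vm.
exists A', C'; split=> //.
- split=> [s x [n [y [ny ->]]]|s x].
    by left; exists n, y; split=> //; have [[AsC _] _ _ _ _] := AC n;
      exact: AsC.
  case=> [[n [y [ny ->]]]|[_ ->]]; last exact: tower_group1.
  have [[_ CH] _ _ _ _] := AC n; apply: tower_groupM; last exact: CH ny.
  by exists p.
- move=> s s' ss' x [u uC ux].
  have C'1 : wo_lt t s' -> x = 1 -> C' s' x by move=> ? ->; right.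
  (* Either infinitely many terms come from the added point [1], or a tail lies in the
     translates. *)
  have [inf1|] := pselect (forall N, exists2 j, (N <= j)%N & (wo_lt t s /\
    u j = 1)).
    have [h [h1 hge _]] := @infinite_sub (fun j => wo_lt t s /\ u j = 1) inf1.
    apply: C'1; first by have [ts _] := h1 0; exact: wo_trans ts ss'.
    apply: (cvg_uniq T1 (cvg_subseq hge ux)).
    have -> : u \o h = fun=> 1 by apply/funext => j; exact: (h1 j).2.
    exact: cvg_cst.
  move=> /existsNP[N nN].
  pose u' j := u (maxn N j).
  have u'x : u' @ \oo --> x by apply: (@cvg_subseq _ u x (maxn N)) => // j;
    exact: leq_maxr.
  have /choice[n /choice[y ny]] : forall j, exists n y, C n s y /\
    u' j = (v n * y)%g.
    move=> j; have [//|ts1] := uC (maxn N j); case: nN; exists (maxn N j) => //.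
    exact: leq_maxl.
  (* A subsequence inside one translate has its limit controlled by the bounds belonging to that
     translate. *)
  have [h [hge [hn|[c hc]]]] := unbounded_or_constant n; last first.
    left; exists c, ((v c)^-1 * x)%g; rewrite mulVKg; split=> //.
    have [_ Ccl _ _ _] := AC c; apply: (Ccl _ _ ss'); exists (y \o h).
      by move=> j; rewrite /= -(hc j); have [] := ny (h j).
    have := cvg_lmulg (a := ((v c)^-1)%g) (cvg_subseq hge u'x).
    apply: cvg_trans; apply: near_eq_cvg; apply: nearW => j /=.
    by have [_ ->] := ny (h j); rewrite -[n (h j)]/((n \o h) j) /= hc mulKg.
  (* For unbounded translates the limit lies in the closed subgroup, so a tail lies in one [L k].
     There the [n]-th translate, for large [n], contains at most [v n]; hence the terms are points
     [v n] and the limit is [1]. *)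
  have [a _ ax] : tower_group x.
    apply: tower_group_cvg u'x => j; have [ny1 ->] := ny j.
    have [[_ CH] _ _ _ _] := AC (n j); apply: tower_groupM; last exact: CH ny1.
    by exists p.
  have [k [M kM]] := tower_cvg ax (cvg_subseq hge u'x).
  have y1 j : (maxn k M <= j)%N -> y (h j) = 1.
    rewrite geq_max => /andP[kj Mj]; have [ny1 uE] := ny (h j).
    have [_ _ _ CL _] := AC (n (h j)); apply: CL ny1 _; apply: vL; rewrite -uE.
    apply: towerS (kM _ Mj); apply: leq_trans kj (leq_trans (hn j) _).
    exact: leq_maxl.
  have r_lt j : (maxn k M <= j)%N -> opt_lt (r (n (h j))) s.
    move=> kMj; apply: contrapT => nrs; have [ny1 _] := ny (h j).
    have [_ _ Cn1 _ _] := AC (n (h j)); apply: (Cn1 _ nrs).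
    by rewrite -(y1 _ kMj).
  apply: C'1.
    (* Otherwise [s] is below [t], and [1] in [C n s] forces [r n] below [s] for arbitrarily large
       [n], against cofinality. *)
    apply: contrapT => nts'; have st : wo_lt s t.
      by have [<-//|s't] := wo_nlt nts'; exact: wo_trans ss' s't.
    have [R rR] := rcof _ st.
    apply: (rR (n (h (maxn (maxn k M) R)))); last by apply: r_lt;
      exact: leq_maxl.
    by apply: leq_trans (hn _); exact: leq_maxr.
  have /cvg_seqP v1' : (v \o (n \o h)) @ \oo --> 1 by exact: cvg_subseq v1.
  apply: (cvg_uniq T1 (cvg_subseq hge u'x)); apply/cvg_seqP => U /v1'[R RU].
  exists (maxn R (maxn k M)) => j; rewrite geq_max => /andP[Rj kMj] /=.
  by have [_ ->] := ny (h j); rewrite (y1 _ kMj) mulg1; exact: RU.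
- move=> s ts [[n [y [ny v1y]]]|[]//]; have [_ _ _ CL _] := AC n.
  have y1 : y = 1 by apply: CL ny _; apply: vLm; rewrite -v1y; exact: tower1.
  by apply: (vm n); rewrite -[v n]mulg1 -y1 -v1y; exact: tower1.
- have vA n s : wo_lt s t -> seq_iter A' (wo_below t) (v n).
    move=> st; have t1 : ord_le ordinal1 (wo_below t) by apply/ord_le1_below;
      exists s.
    have [_ _ _ _] := AC n; move: (rt n); case: (r n) => [s' /= s't|_ /= An1].
      move=> /(seq_iter_continuous (B := A') (f := fun y => v n * y)%g).
      rewrite mulg1 => H; apply: seq_iter_mono (H _ _); last 2 first.
      + exact: continuous_lmulg.
      + by move=> y ny; exists n, y.
      (* As [s'] is below [t], stage [s' + 1] is at most [t]; the third case is contradictory. *)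
      have [lt|[eq|lt]] := ord_trichotomy (ord_succ (wo_below s')) (wo_below t);
        [by left|by right|].
      have [lt'|eq] := (ord_lt_succP _ _).1 lt.
        by case: (ord_lt_irr (ord_lt_trans lt' (ord_lt_below s't))).
      by case: (ord_lt_irr (ord_eq_lt eq (ord_lt_below s't))).
    apply: seq_iter_gt0 => //; apply: seq_closure_sub.
    by exists n, 1; rewrite mulg1.
  (* For minimal [t] the stage [wo_below t] is stage 0, which is empty; then the [v n] are found in
     [A'] itself. *)
  have [[s st]|ns] := pselect (exists s, wo_lt s t).
    rewrite seq_iter_succ; first by exists v => // n; exact: vA st.
    by apply/ord_le1_below; exists s.
  have le1 : ord_le ordinal1 (ord_succ (wo_below t)) by apply: ord_le_inhabited;
    exact: None.
  apply: (seq_iter_gt0 le1); exists v => // n; exists n, 1; rewrite mulg1;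
    split=> //.
  have [_ _ _ _] := AC n; move: (rt n); case: (r n) => // s st.
  by case: ns; exists s.
Qed.

End gap.

(** A gap in [ord_succ a] at its top element, whose segment is [a], puts [1] in stage [a + 1] of [A]
    but not in stage [a]. *)
Lemma seq_iter_unstable (a : wellorder) : ord_le ordinal1 a ->
  countable [set: a] ->
  exists A : set G, seq_iter A (ord_succ a) <> seq_iter A a.
Proof.
move=> a1 acnt; have bcnt : countable [set: ord_succ a].
  have /countable_injP[c cinj] := acnt.
  apply/countable_injP; exists (fun x : option a => if x is Some y then (c y).+1
    else 0).
  by move=> [x|] [y|] _ _ // [] /cinj -> //; rewrite inE.
(* The outer [Some] marks a stage other than [-1]; the inner [None] is the top element of
   [ord_succ a]. *)
have [A [C [[AC _] Ccl Cn1 _ A1]]] := gapP bcnt (Some (None : ord_succ a)) 0.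
exists A => AE; have := @wo_irr (ord_succ a) None => /Cn1; apply.
have aE := ord_eq_below_None a.
have AN : seq_iter A (@wo_below (ord_succ a) None) 1.
  apply: seq_iter_eq (ord_eq_sym aE) _; rewrite -AE seq_iter_succ//.
  move: A1; rewrite seq_iter_succ; first by apply: seq_closureS => x;
    exact: seq_iter_eq.
  by case: a1 => [lt|eq]; [left; apply: ord_lt_transr (ord_eq_sym aE)|right;
    apply: ord_eq_trans (ord_eq_sym aE)].
have sub : forall s : ord_succ a, seq_iter A (wo_below s) `<=` C s.
  move=> s; elim/(well_founded_ind (@wo_wf (ord_succ a))): s => s IH x.
  move E : (wo_below s) => o xA; case: xA E => [c y c1 Ay oc|c d y d1 dc Ay oc].
    have /ord_le1_below[s' s's] : ord_le ordinal1 (wo_below s).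
      by rewrite oc; right; exact: ord_eq_sym.
    by apply: (Ccl _ _ s's); apply: seq_closureS Ay; exact: AC.
  rewrite -oc in dc; have [s' s's ds'] := ord_lt_belowP dc.
  apply: (Ccl _ _ s's); apply: seq_closureS Ay => z dz.
  by apply: (IH _ s's); exact: seq_iter_eq dz.
exact: sub AN.
Qed.

Lemma sequential_order_tower : ord_eq (sequential_order G) omega1.
Proof. exact: sequential_order_omega1 seq_iter_unstable. Qed.

End fan.
End tower.

(** * Global cardinal invariants *)

(** By Zorn's lemma; a point related to no point of a maximal [S] could be added to it. *)
Lemma max_separated (T : Type) (R : T -> T -> Prop) :
  (forall x y, R x y -> R y x) -> (forall x, R x x) ->
  exists S : set T, (forall x y, S x -> S y -> R x y -> x = y) /\
    forall y, exists2 x, S x & R x y.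
Proof.
move=> Rsym Rrefl.
pose P := [set S : set T | forall x y, S x -> S y -> R x y -> x = y].
have [F FP totF x y [X FX Xx] [Y FY Yy]|S [SP Smax]] := @Zorn_bigcup _ P.
  by have [XY|YX] := totF _ _ FX FY; [apply: (FP Y)|apply: (FP X)]; auto.
exists S; split=> // y; apply: contrapT => ny.
apply: (Smax (S `|` [set y])); first split; first by left.
  by move=> /(_ y (or_intror erefl)) Sy; apply: ny; exists y.
move=> a b [Sa|->] [Sb|->] // Rab; first exact: SP.
  by case: ny; exists a.
by case: ny; exists b => //; exact: Rsym.
Qed.

(** * Invariants bounded by the network weight *)

Section network_inequalities.
Variable X : topologicalType.

Lemma network_weight_le (N : set (set X)) : network N -> [set: network_weight X]
  #<= N.
Proof. exact: min_size_le. Qed.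

Lemma network_weight_sat : exists2 N : set (set X), network N &
  N #= [set: network_weight X].
Proof.
apply: (@min_size_sat _ _ setT) => U x oU Ux.
by exists U; split=> //; exact: subset_refl.
Qed.

Lemma k_network_weight_sat :
  exists2 N : set (set X), k_network N & N #= [set: k_network_weight X].
Proof.
apply: (@min_size_sat _ _ setT) => U C oU Cc CU; exists [set U].
by rewrite bigcup_set1; split=> //; exact: finite_set1.
Qed.

Lemma network_weight_le_k : [set: network_weight X] #<= [set: k_network_weight
  X].
Proof.
have [N Nk /card_eqW[NK _]] := k_network_weight_sat.
apply: card_le_trans NK; apply: network_weight_le => U x oU Ux.
have [|M [_ MN /(_ x erefl)[A MA Ax] MU]] := Nk U [set x] oU (@compact_set1 _
  x).
  by move=> _ ->.
by exists A; split=> //; [exact: MN|apply: subset_trans MU; exact: bigcup_sup].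
Qed.

Lemma density_le_network : [set: density X] #<= [set: network_weight X].
Proof.
have [N Nn /card_eqW[NK _]] := network_weight_sat.
(* The values are optional because an empty space has no point to select. *)
have /choice[p pP] : forall A : set X, exists x : option X, A !=set0 ->
    exists2 y, A y & x = Some y.
  move=> A; have [[y Ay]|nA] := pselect (A !=set0); last by exists None.
  by exists (Some y) => _; exists y.
apply: card_le_trans NK.
apply: (@card_le_trans _ _ _ [set x | exists2 A, N A & p A = Some x]).
  apply: min_size_le => O [x Ox] oO.
  have [A [NA Ax AO]] := Nn _ _ oO Ox.
  have [|y Ay py] := pP A; first by exists x.
  by exists y; split; [exact: AO|exists A].
apply: (@card_le_rel _ _ _ _ (fun A x => p A = Some x)) => [A x y _ _ ->
  []//|x [A NA pA]].
by exists A.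
Qed.

(** In a disjoint family, a non-empty network member inside [U] determines [U]. *)
Lemma cellularity_le_network : [set: cellularity X] #<= [set: network_weight X].
Proof.
have [N Nn /card_eqW[NK _]] := network_weight_sat.
apply: min_card_le => -[F [Fopen Ftriv /negP]]; apply.
apply: card_le_trans NK.
apply: (@card_le_rel _ _ _ _ (fun A U => A !=set0 /\ A `<=` U)) =>
  [A U V FU FV [[x Ax] AU] [_ AV]|U FU].
  by apply: Ftriv => //; exists x; split; [exact: AU|exact: AV].
have [oU [x Ux]] := Fopen _ FU; have [A [NA Ax AU]] := Nn _ _ oU Ux.
by exists A => //; split=> //; exists x.
Qed.

Lemma extent_le_network : [set: extent X] #<= [set: network_weight X].
Proof.
have [N Nn /card_eqW[NK _]] := network_weight_sat.
apply: min_card_le => -[D [_ Disol /negP]]; apply.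
apply: card_le_trans NK.
apply: (@card_le_rel _ _ _ _ (fun A x => A x /\ forall y, D y -> A y ->
  y = x)) => [A x y Dx Dy [Ax Aall] [Ay Ball]|x Dx].
  exact: Ball.
have [_ [V xV VD]] := Disol _ Dx.
move: xV; rewrite nbhsE => -[O [oO Ox] OV].
have [A [NA Ax AO]] := Nn _ _ oO Ox; exists A => //; split=> // y Dy Ay.
have : [set x] y by rewrite -VD; split=> //; exact/OV/AO.
by [].
Qed.

(** For each network member contained in some set of the cover, one such set is kept. *)
Lemma lindelof_le_network : [set: lindelof_number X] #<= [set: network_weight
  X].
Proof.
have [N Nn /card_eqW[NK _]] := network_weight_sat.
apply: min_card_le => C Copen Ccov.
have /choice[p pP] : forall A : set X, exists W, (exists2 V, C V & A `<=` V) ->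
  C W /\ A `<=` W.
  move=> A; have [[V CV AV]|nA] := pselect (exists2 V, C V & A `<=` V);
    last by exists setT.
  by exists V.
exists (p @` [set A | N A /\ exists2 V, C V & A `<=` V]); split.
- by move=> _ [A [_ /pP[CA _]] <-].
- apply/seteqP; split=> // x _.
  have [V CV Vx] : (\bigcup_(U in C) U) x by rewrite Ccov.
  have [A [NA Ax AV]] := Nn _ _ (Copen _ CV) Vx.
  have CA : exists2 V, C V & A `<=` V by exists V.
  by exists (p A); [exists A|apply: (pP A CA).2].
- apply: card_le_trans NK; apply: card_le_trans (card_image_le _ _) _.
  by apply: subset_card_le => A [].
Qed.

End network_inequalities.

(** * Invariants bounding the boundedness index from above *)

Section boundedness.
Variable G : topologicalGroupType.
Implicit Types (x y z : G) (A U V : set G) (u v : nat -> G).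
Local Notation "1" := (1%g : G).

Lemma open_translate x V : open V -> open [set z | V (x^-1 * z)%g].
Proof.
move=> oV; apply: (@open_comp _ _ (fun z => x^-1 * z)%g V) => // z _.
exact: continuous_lmulg.
Qed.

Lemma boundedness_sat U : open U -> U !=set0 ->
  exists2 F : set G, F #<= [set: boundedness_index G] &
    [set (x * y)%g | x in F & y in U] = setT.
Proof.
move: U; apply: (@min_card_sat (fun K => forall U : set G, open U -> U !=set0 ->
    exists2 F : set G, F #<= [set: K] & [set (x * y)%g | x in F &
      y in U] = setT) G).
move=> U _ [y Uy]; exists setT; first exact: card_lexx.
apply/seteqP; split=> // x _; exists (x * y^-1)%g => //; exists y => //.
by rewrite mulgVK.
Qed.

Lemma boundedness_le (K : Type) :
  (forall U, nbhs 1 U -> exists2 F : set G, F #<= [set: K] & forall x,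
    exists2 f, F f & U (f^-1 * x)%g) ->
  [set: boundedness_index G] #<= [set: K].
Proof.
move=> H; apply: min_card_le => U oU [y Uy].
have [|F FK FU] := H [set z | U (y * z)%g].
  by apply: nbhs_lmulg; rewrite mulg1; apply: open_nbhs_nbhs.
exists [set (f * y^-1)%g | f in F].
  by apply: card_le_trans (card_image_le _ _) FK.
apply/seteqP; split=> // x _; have [f Ff Uf] := FU x.
exists (f * y^-1)%g; first by exists f.
by exists (y * (f^-1 * x))%g => //; rewrite -mulgA mulKg mulVKg.
Qed.

(** Take a maximal [S] for which the translates of the interior of [V] are pairwise disjoint. Every
    other translate meets one of these, which puts [y] in [x V V^-1], hence in [x U]. *)
Lemma boundedness_le_cellularity :
  [set: boundedness_index G] #<= [set: cellularity G].
Proof.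
apply: boundedness_le => U /nbhs1_mul[V [V1 Vi VU]].
pose R x y := exists z, V° (x^-1 * z)%g /\ V° (y^-1 * z)%g.
have oV x : open [set z | V° (x^-1 * z)%g].
  by apply: open_translate; exact: open_interior.
have [x y [z [? ?]]|x|S [Ssep Smax]] := @max_separated _ R.
- by exists z.
- by exists x; rewrite mulVg.
exists S; last first.
  move=> y; have [x Sx [z [/interior_subset Vx /interior_subset Vy]]] := Smax y.
  exists x => //; rewrite -[y](mulVKg z) mulgA; apply: VU => //.
  by have := Vi _ Vy; rewrite invgM invgK.
pose T x := [set z | V° (x^-1 * z)%g].
have TS : T @` S #<= [set: cellularity G].
  apply: contrapT => nle.
  (* The cardinal of [set G] bounds every such family, so the default value is not taken. *)
  have := @min_card_sat (fun K => ~ exists F : set (set G),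
    [/\ forall U, F U -> open U /\ U !=set0, trivIset F id &
        ~~ (F #<= [set: K])]) (set G).
  apply=> [[F [_ _ /negP]]|]; first by apply; exact: card_leT.
  exists (T @` S); split; last exact/negP.
  - by move=> _ [x Sx <-]; split; [exact: oV|exists x; rewrite /T /= mulVg].
  - move=> _ _ [x Sx <-] [y Sy <-] [z [Tx Ty]].
    by rewrite (Ssep x y)//; exists z.
apply: card_le_trans TS.
apply: (@card_le_rel _ _ _ _ (fun W x => T x = W)) => [W x y Sx Sy Tx Ty|x Sx].
  apply: Ssep => //; exists x; split; first by rewrite mulVg.
  have : T y x by rewrite Ty -Tx /T /= mulVg.
  by [].
by exists (T x) => //; exists x.
Qed.

Lemma boundedness_le_density : [set: boundedness_index G] #<= [set: density G].
Proof.
have [|D Dd /card_eqW[DK _]] := @min_size_sat _ (fun D : set G => dense D) setT.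
  by move=> O [x Ox] _; exists x.
apply: boundedness_le => U /nbhs1_mul[V [V1 Vi VU]]; exists D => // x.
have oV : open [set z | V° (x^-1 * z)%g].
  by apply: open_translate; exact: open_interior.
have [|z [/interior_subset Vz Dz]] := Dd _ _ oV.
  by exists x; rewrite /= mulVg; exact: nbhs_singleton (nbhs_interior V1).
exists z => //; rewrite -[(_ * _)%g]mulg1; apply: VU;
  last exact: nbhs_singleton.
by have := Vi _ Vz; rewrite invgM invgK.
Qed.

Lemma boundedness_le_lindelof :
  [set: boundedness_index G] #<= [set: lindelof_number G].
Proof.
apply: boundedness_le => U U1.
pose T x := [set z | U° (x^-1 * z)%g].
have oT x : open (T x).
  by apply: open_translate; exact: open_interior.
have Tx x : T x x by rewrite /T /= mulVg; exact: nbhs_singleton (nbhs_interior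
  U1).
have [|||D [DT Dcov DK]] := @min_card_sat (fun K => forall C : set (set G),
    C `<=` open -> \bigcup_(U in C) U = setT ->
    exists D : set (set G),
      [/\ D `<=` C, \bigcup_(U in D) U = setT & D #<= [set: K]]) (set G) _
        (range T).
- by move=> C _ Ccov; exists C; split=> //; exact: card_leT.
- by move=> _ [x _ <-].
- by apply/seteqP; split=> // x _; exists (T x) => //; exists x.
have /choice[p pP] : forall W, exists x, D W -> T x = W.
  by move=> W; have [/DT[x _ <-]|nD] := pselect (D W); [exists x|exists 1].
exists (p @` D); first exact: card_le_trans (card_image_le _ _) DK.
move=> x; have [W DW Wx] : (\bigcup_(U in D) U) x by rewrite Dcov.
exists (p W); first by exists W.
have : T (p W) x by rewrite (pP W DW).
exact: interior_subset.
Qed.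

(** A maximal [V]-separated set is closed and discrete: each translate [z W] contains at most one of
    its points. *)
Lemma boundedness_le_extent : accessible_space G ->
  [set: boundedness_index G] #<= [set: extent G].
Proof.
move=> T1; apply: boundedness_le => U /nbhs1_sub[V [V1 Vi VU _]].
have [x y|x|S [Ssep Smax]] := @max_separated _ (fun x y => V (x^-1 * y)%g).
- by move=> /Vi; rewrite invgM invgK.
- by rewrite mulVg; exact: nbhs_singleton.
exists S; last by move=> y; have [x Sx /VU] := Smax y; exists x.
apply: contrapT => nle.
have := @min_card_sat (fun K => ~ exists D : set G,
    [/\ closed D, D `<=` isolated D & ~~ (D #<= [set: K])]) G.
apply=> [[D [_ _ /negP]]|]; first by apply; exact: card_leT.
have [W [W1 Wi WV]] := nbhs1_mul V1.
have Wuniq z x y : S x -> S y -> W (z^-1 * x)%g -> W (z^-1 * y)%g -> x = y.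
  move=> Sx Sy /Wi zx zy; apply: Ssep => //.
  by have := WV _ _ zx zy; rewrite invgM invgK -mulgA mulVKg.
exists S; split; last exact/negP.
- move=> z clz; have [x [Sx Wx]] := clz _ (nbhs1_lmulg z W1).
  have [->//|zx] := pselect (z = x).
  have [y [Sy [Wy yx]]] := clz _ (filterI (nbhs1_lmulg z W1) (nbhs_neq T1 zx)).
  by case: yx; exact: Wuniq Wy Wx.
- move=> x Sx; split; first exact: mem_set.
  exists [set z | V (x^-1 * z)%g]; first exact: nbhs1_lmulg.
  apply/seteqP; split=> [y [Vy Sy]|y ->]; first by rewrite (Ssep x y).
  by split=> //=; rewrite mulVg; exact: nbhs_singleton.
Qed.

(** Given [n + 1] points, some neighborhood of [1] misses the quotients of distinct ones. Each of
    the [n] translates of a smaller [V] that cover [G] then contains at most one of the points. *)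
Lemma boundedness_finite : accessible_space G ->
  ~ ([set: nat] #<= [set: boundedness_index G]) ->
  [set: G] #<= [set: boundedness_index G].
Proof.
move=> T1 /finite_setPn[n /card_eqW[In nI]].
apply: card_le_trans nI; apply: contrapT => Gn.
have [A An] : exists A : set G, A #= `I_n.+1.
  have /card_subP[A ?] : `I_n.+1 #<= [set: G]; last by exists A.
  have [Gfin|/infiniteP Ginf] := pselect (finite_set [set: G]); last first.
    exact: card_le_trans (card_leT _) Ginf.
  have [m /card_eqW[Gm mG]] := Gfin; apply: card_le_trans mG.
  rewrite card_le_II ltnNge; apply/negP => mn; apply: Gn.
  by apply: card_le_trans Gm _; rewrite card_le_II.
have Afin : finite_set A by exists n.+1.
pose E : set G := [set z | exists a b, [/\ A a, A b, a <> b &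
  z = (a^-1 * b)%g]].
have Efin : finite_set E.
  apply: (@sub_finite_set _ _ [set (a^-1 * b)%g | a in A & b in A]).
    by move=> _ [a [b [Aa Ab _ ->]]]; exists a => //; exists b.
  exact: finite_image2.
have E1 : nbhs 1 (~` E).
  apply: open_nbhs_nbhs; split.
    by apply: closed_openC; exact: (accessible_finite_set_closed.1 T1 E Efin).
  move=> [a [b [_ _ ab /(congr1 (fun z => a * z)%g)]]].
  by rewrite mulg1 mulVKg.
have [V [V1 Vi VE]] := nbhs1_mul E1.
have [|F FK FV] := @boundedness_sat V° (@open_interior _ _).
  by exists 1; exact: nbhs_singleton (nbhs_interior V1).
have AF : A #<= F.
  apply: (@card_le_rel _ _ _ _ (fun f a => V (f^-1 * a)%g)) =>
    [f a b Aa Ab fa fb|a Aa].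
    apply: contrapT => ab; apply: (VE _ _ (Vi _ fa) fb); exists a, b;
      split=> //.
    by rewrite invgM invgK -mulgA mulVKg.
  have [f Ff [v /interior_subset Vv fv]] : [set (x * y)%g | x in F &
    y in V°] a by rewrite FV.
  by exists f => //; rewrite -fv mulKg.
have : `I_n.+1 #<= `I_n.
  apply: card_le_trans (card_le_trans AF (card_le_trans FK In)).
  by have [] := card_eqW An.
by rewrite card_le_II ltnn.
Qed.

Lemma k_network_weight_le_card : accessible_space G -> finite_set [set: G] ->
  [set: k_network_weight G] #<= [set: G].
Proof.
move=> T1 Gfin; apply: card_le_trans (card_image_le (fun x => [set x]) setT).
apply: min_size_le => U C oU _ CU; exists [set [set x] | x in C]; split.
- by apply: finite_image; apply: sub_finite_set Gfin.
- by move=> _ [x _ <-]; exists x.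
- by move=> x Cx; exists [set x] => //; exists x.
- by move=> x [_ [y /CU ? <-] ->].
Qed.

End boundedness.

(** Without a finite subcover, the sets containing [C] minus finitely many [f i] form a proper
    filter. A cluster point of it in [C] lies in some [f i], which is disjoint from a member of the
    filter. *)
Lemma compact_finite_cover (X : topologicalType) (I : Type) (C : set X) (D :
  set I)
    (f : I -> set X) :
  compact C -> (forall i, D i -> open (f i)) ->
  (forall x, C x -> exists2 i, D i & f i x) ->
  exists E : set I, [/\ finite_set E, E `<=` D & forall x, C x -> exists2 i,
    E i & f i x].
Proof.
move=> Ccomp fo fcov; apply: contrapT => nex.
pose F : set_system X := [set A | exists E : set I, [/\ finite_set E, E `<=` D &
  forall x, C x -> (forall i, E i -> ~ f i x) -> A x]].
have FF : ProperFilter F.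
  split.
    move=> [E [Efin ED E0]]; apply: nex; exists E; split=> // x Cx.
    by apply: contrapT => nE; apply: (E0 x) => // i Ei fix_; apply: nE;
      exists i.
  split=> [|A B [E [Efin ED EA]] [E' [E'fin E'D E'B]]|A B AB [E [Efin ED EA]]].
  - by exists set0; split; [exact: finite_set0|exact: sub0set|].
  - exists (E `|` E'); split; first by rewrite finite_setU.
      by move=> i [/ED|/E'D].
    move=> x Cx nEE; split; first by apply: EA => // i Ei; apply: nEE; left.
    by apply: E'B => // i Ei; apply: nEE; right.
  - by exists E; split=> // x Cx nE; apply/AB/EA.
have [|x [Cx clx]] := Ccomp F FF; first by exists set0; split;
  [exact: finite_set0|exact: sub0set|].
have [i Di fix_] := fcov x Cx.
have [|y [fiy nfiy]] := clx (C `&` ~` f i) (f i) _ (open_nbhs_nbhs (conj (fo i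
  Di) fix_)).
  exists [set i]; split; [exact: finite_set1|by move=> _ ->|].
  by move=> z Cz nz; split=> //; exact: nz.
by case: fiy.
Qed.

(** * k-networks of the size of the boundedness index *)

Section k_networks.
Variable G : topologicalGroupType.
Implicit Types (x y z : G) (A U V : set G) (u v : nat -> G).
Local Notation "1" := (1%g : G).
Hypothesis T1 : accessible_space G.

(** Countably many families of size at most an infinite cardinal are counted by [card_prod_nat]. *)
Lemma k_network_weight_le_prod (I : countType) (F : I -> set G)
    (T : G -> I -> set G) :
  [set: nat] #<= [set: boundedness_index G] ->
  (forall i, F i #<= [set: boundedness_index G]) ->
  k_network [set A | exists i x, F i x /\ A = T x i] ->
  [set: k_network_weight G] #<= [set: boundedness_index G].
Proof.
move=> ibinf Fle Nk; apply: card_le_trans (min_size_le Nk) _.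
apply: card_le_trans (card_prod_nat ibinf).
have /choice[R RP] : forall i, exists R : G -> boundedness_index G -> Prop,
    [/\ forall x, F i x -> exists2 l, True & R x l &
        forall x y l, R x l -> R y l -> x = y].
  by move=> i; have [R [H1 _ H2]] := card_le_ex (Fle i); exists R.
apply: (@card_le_rel _ _ _ _ (fun p A => exists i x, [/\ pickle i = p.2,
  R i x p.1 & A = T x i])).
  move=> [l n] A B _ _ /= [i [x [<- Rx ->]]] [j [y [/(pcan_inj pickleK) ij Ry
    ->]]].
  by rewrite ij in Ry *; have [_ Rinj] := RP i; rewrite (Rinj x y l).
move=> A [i [x [Fx ->]]]; have [/(_ x Fx)[l _ Rl] _] := RP i.
by exists (l, pickle i) => //; exists i, x.
Qed.

(** For each [n], boundedly many translates of the interior of [V n] cover [G]. All these translates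
    form a base, and compactness extracts finite covers from it. *)
Lemma first_countable_k_network (V : nat -> set G) :
  (forall n, nbhs 1 (V n)) -> (forall U, nbhs 1 U -> exists n, V n `<=` U) ->
  [set: nat] #<= [set: boundedness_index G] ->
  [set: k_network_weight G] #<= [set: boundedness_index G].
Proof.
move=> V1 VU ibinf.
have /choice[F FP] : forall n, exists F : set G,
    F #<= [set: boundedness_index G] /\ forall x, exists2 f, F f &
      (V n)° (f^-1 * x)%g.
  move=> n; have [||F FK FV] := @boundedness_sat G (V n)°;
    first exact: open_interior.
    by exists 1; exact: nbhs_singleton (nbhs_interior (V1 n)).
  exists F; split=> // x.
  have [f Ff [v Vv <-]] : [set (x * y)%g | x in F & y in (V n)°] x by rewrite
    FV.
  by exists f => //; rewrite mulKg.
pose T x n := [set z | (V n)° (x^-1 * z)%g].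
have oT x n : open (T x n) by apply: open_translate; exact: open_interior.
apply: (@k_network_weight_le_prod nat F T ibinf) => [n|U C oU].
  by have [] := FP n.
move=> Ccomp CU.
have [p _|z Cz|D' [D'fin D'D Ccov]] := @compact_finite_cover _ _ C
    [set p : G * nat | F p.2 p.1 /\ T p.1 p.2 `<=` U] (fun p =>
      T p.1 p.2) Ccomp.
- exact: oT.
- have /nbhs1_mul[W [W1 Wi WU]] : nbhs 1 [set t | U (z * t)%g].
    by apply: nbhs_to1; apply: open_nbhs_nbhs; split=> //; exact: CU.
  have [n VW] := VU _ W1; have [_ /(_ z)[f Ff fz]] := FP n.
  exists (f, n) => //; split=> // y /interior_subset/VW fy.
  have /VW/Wi zf := interior_subset fz.
  by have := WU _ _ zf fy; rewrite /= invgM invgK mulgA mulVKg mulVKg.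
- exists [set T p.1 p.2 | p in D']; split.
  + exact: finite_image.
  + by move=> _ [[x n] /D'D[/= Fx _] <-]; exists n, x.
  + by move=> z /Ccov[p pD' Tz]; exists (T p.1 p.2) => //; exists p.
  + by move=> z [_ [p /D'D[_ TU] <-] /TU].
Qed.

Hypothesis sequential : sequential_space G.

Lemma topological_group_hausdorff : hausdorff_space G.
Proof.
move=> p q pq; apply: contrapT => npq.
have [|V [V1 Vi VU]] := @nbhs1_mul G [set z | z <> (p^-1 * q)%g].
  apply: (nbhs_neq T1) => /(congr1 (fun z => p * z)%g).
  by rewrite mulg1 mulVKg.
have [z [/= pz qz]] := pq _ _ (nbhs1_lmulg p V1) (nbhs1_lmulg q V1).
apply: (VU _ _ pz (Vi _ qz)).
by rewrite invgM invgK mulgA mulgK.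
Qed.

(** Without convergent subsequences all tails [T m] are closed, so a cluster point lies in every
    tail; it is a value taken infinitely often, which gives a constant subsequence. *)
Lemma compact_seq_lim C u : compact C -> (forall n, C (u n)) ->
  exists (h : nat -> nat) y, [/\ forall j, (j <= h j)%N, (u \o h) @ \oo -->
    y & C y].
Proof.
move=> Ccomp uC; have Ccl := compact_closed topological_group_hausdorff Ccomp.
apply: contrapT => nconv'.
have nconv h y : (forall j, (j <= h j)%N) -> ~ (u \o h) @ \oo --> y.
  move=> hge uy; apply: nconv'; exists h, y; split=> //.
  by apply: closed_seq Ccl _ uy => n; exact: uC.
pose T m := [set x | exists k, (m <= k)%N /\ u k = x].
have Tcl m : closed (T m).
  apply: (seq_closed sequential) => v x /choice[k kP] vx.
  have [h [hge [hk|[c hc]]]] := unbounded_or_constant k.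
    case: (nconv (k \o h) x hk); have := cvg_subseq hge vx.
    by apply: cvg_trans; apply: near_eq_cvg; apply: nearW => j /=; have [] :=
      kP (h j).
  exists c; split; first by rewrite -(hc 0); have [] := kP (h 0).
  apply: (@cvg_uniq _ T1 (v \o h)); last exact: cvg_subseq vx.
  have -> : v \o h = fun=> u c.
    by apply/funext => j /=; have [_ <-] := kP (h j); rewrite hc.
  exact: cvg_cst.
have [|y [Cy cly]] := Ccomp (u @ \oo) _; first by exists 0 => // n _; exact: uC.
have yT m : T m y.
  apply: Tcl => B yB; have [|z [Tz Bz]] := cly (T m) B _ yB.
    by exists m => // n mn; exists n.
  by exists z.
have [h [hP hge _]] := @infinite_sub (fun n => u n = y) (fun N =>
  let: ex_intro k (conj a b) := yT N in ex_intro2 _ _ k a b).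
apply: (nconv h y hge).
have -> : u \o h = fun=> y by apply/funext => j; exact: hP.
exact: cvg_cst.
Qed.

Variable F : nat -> set G.
Hypothesis Fcs : cs_star_sequence F.
Variable L : nat -> set G.
Hypothesis Ltower : tower L.

(** Otherwise a sequence in [L n] is chosen with no quotient of an earlier by a later term in [B]. A
    convergent subsequence has late quotients near [1] and in [L n.+3], hence in [B]. *)
Lemma tower_totally_bounded n B : barrier_in (L n.+3) B ->
  exists (f : nat -> G) k, forall x, L n x -> exists j, (j < k)%N /\
    B ((f j)^-1 * x)%g.
Proof.
move=> Bbar; apply: contrapT => nex.
have [f fP] : exists f : nat -> G, forall k, L n (f k) /\
    forall j, (j < k)%N -> ~ B ((f j)^-1 * f k)%g.
  apply: (@history_choice G (fun k f x => L n x /\ forall j, (j < k)%N ->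
    ~ B ((f j)^-1 * x)%g) 1).
    move=> k f; apply: contrapT => nx; apply: nex; exists f, k => x nx'.
    apply: contrapT => nj; apply: nx; exists x; split=> // j jk Bj.
    by apply: nj; exists j.
  by move=> k f g x fg [nx fB]; split=> // j jk; rewrite -fg//; exact: fB.
have [|h [y [hge fy]]] := tower_seq_compact Ltower (n := n) (u := f).
  by move=> k; have [] := fP k.
have [V [V1 _ VB]] := tower_nbhs sequential Fcs Ltower Bbar.
have [W [W1 Wi WV]] := nbhs1_mul V1.
have [N NW] := (cvg_seqP _ _).1 (cvg_to1 fy) _ W1.
pose M := maxn N (h N).+1.
have lt : (h N < h M)%N by apply: leq_trans (hge M); exact: leq_maxr.
have [_ /(_ _ lt)] := fP (h M); apply; apply: VB.
  have /Wi fN := NW N (leqnn N); have := WV _ _ fN (NW M (leq_maxl _ _)).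
  by rewrite /= invgM invgK -mulgA mulVKg.
by apply: (towerVM Ltower); [have [] := fP (h N)|have [] := fP (h M)].
Qed.

(** Cover [L m] by finitely many translates of a small [D]; one of them contains infinitely many
    terms of the sequence. The centers [f] depend only on the level and the list [s], so countably
    many sets suffice. *)
Lemma tower_cs_network : exists E : nat -> set G, forall x u U,
  tower_group L x -> u @ \oo --> x -> nbhs x U ->
  exists2 i, E i `<=` U & forall N, exists2 n, (N <= n)%N & E i (u n).
Proof.
have /choice[f fP] : forall ns : nat * seq nat, exists f : nat -> G,
    barrier_in (L ns.1.+3) (difference F ns.2) -> exists k, forall x,
      L ns.1 x ->
      exists j, (j < k)%N /\ difference F ns.2 ((f j)^-1 * x)%g.
  move=> [n s]; have [/tower_totally_bounded[f fk]|nb] :=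
    pselect (barrier_in (L n.+3) (difference F s)).
    by exists f.
  by exists (fun=> 1).
pose E (p : nat * seq nat * nat) := [set x | difference F p.1.2 ((f p.1 p.2)^-1
  * x)%g].
exists (fun i => if unpickle i is Some p then E p else set0) =>
  x u U [a _ ax] ux xU.
have [m [N mN]] := tower_cvg Ltower ax ux.
have [V [V1 Vi VU]] := nbhs1_mul (nbhs_to1 xU).
have [W [W1 Wi WV]] := nbhs1_mul V1.
have [s [sW sbar]] := tower_difference Fcs Ltower m.+3 W1.
have [k kP] := fP (m, s) sbar.
have [j jk jinf] : exists2 j, (j < k)%N & forall N, exists2 n, (N <= n)%N &
  E (m, s, j) (u n).
  apply: contrapT => nj.
  have [j jk|M MP] := @eventually_all_lt (fun j n => ~ E (m, s, j) (u n)) k.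
    apply: contrapT => /not_eventually H; apply: nj; exists j => // N'.
    by have [n ? /contrapT ?] := H N'; exists n.
  have [j [jk Ej]] := kP _ (mN _ (leq_maxl N M)).
  exact: (MP _ _ jk (leq_maxr N M)).
exists (pickle (m, s, j)); rewrite pickleK// => y /sW Wy.
have [M MV] := (cvg_seqP _ _).1 (cvg_to1 ux) _ V1.
have [n Mn /sW/Wi] := jinf M; rewrite invgM invgK => Wn.
have := VU _ _ (MV n Mn) (WV _ _ Wn Wy).
by rewrite /= !mulgA mulgV mul1g mulgK mulgV mul1g.
Qed.

(** A compact set is covered by finitely many translates of the open subgroup. If no finite union of
    admissible sets covered it, points missed by longer and longer unions would have a convergent
    subsequence, against [tower_cs_network]. *)
Lemma tower_k_network : [set: nat] #<= [set: boundedness_index G] ->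
  [set: k_network_weight G] #<= [set: boundedness_index G].
Proof.
move=> ibinf; have [E EP] := tower_cs_network.
have H1 := tower_group1 Ltower.
have oH := open_tower_group sequential Ltower.
have [|R RK RH] := boundedness_sat oH; first by exists 1.
apply: (@k_network_weight_le_prod nat (fun=> R) (fun x i => [set z | E i (x^-1 *
  z)%g]) ibinf) => // U C oU Ccomp CU.
have [x _|z Cz|S [Sfin SR Scov]] := @compact_finite_cover _ _ C R (fun x =>
  [set z | tower_group L (x^-1 * z)%g]) Ccomp.
- exact: open_translate.
- have [x Rx [y Hy <-]] : [set (x * y)%g | x in R & y in tower_group L] z by
    rewrite RH.
  by exists x => //=; rewrite mulKg.
(* Translates of [E p.2] inside [U] with index at most [n] and one of the finitely many shifts in
   [S]. *)
pose good n (p : G * nat) := [/\ S p.1, (p.2 <= n)%N & [set z | E p.2 (p.1^-1 *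
  z)%g] `<=` U].
pose M n := (fun p : G * nat => [set z | E p.2 (p.1^-1 * z)%g]) @` good n.
apply: contrapT => nM.
have /choice[c cP] : forall n, exists c, C c /\ forall p, good n p ->
  ~ E p.2 (p.1^-1 * c)%g.
  move=> n; apply: contrapT => nc; apply: nM; exists (M n); split.
  - apply: finite_image; apply: (@sub_finite_set _ _ (S `*` `I_n.+1)).
      by move=> [x i] [/= Sx ni _]; split.
    by apply: finite_setX => //; exact: finite_II.
  - by move=> _ [[x i] [/= Sx _ _] <-]; exists i, x; split=> //; exact: SR.
  - move=> z Cz; apply: contrapT => nz; apply: nc; exists z; split=> // p gp Ez.
    by apply: nz; exists [set z | E p.2 (p.1^-1 * z)%g] => //; exists p.
  - by move=> z [_ [p [_ _ pU] <-] /pU].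
have [|h [y [hge cy Cy]]] := compact_seq_lim Ccomp (u := c).
  by move=> n; have [] := cP n.
have [x Sx Hxy] := Scov _ Cy.
have [||i EU Einf] := EP (x^-1 * y)%g (fun j => x^-1 * c (h j))%g [set t | U (x
  * t)%g] Hxy.
- exact: cvg_lmulg.
- by apply: nbhs_lmulg; rewrite mulVKg; apply: open_nbhs_nbhs; split=> //;
    exact: CU.
have [j ij Ej] := Einf i.
have [_ /(_ (x, i))] := cP (h j); apply=> //; split=> //=.
  exact: leq_trans (hge j).
by move=> z /EU; rewrite /= mulVKg.
Qed.

End k_networks.

(** * Characters *)

Section characters.
Variable G : topologicalGroupType.
Implicit Types (x y z : G) (A U V : set G) (u v : nat -> G).
Local Notation "1" := (1%g : G).
Hypothesis T1 : accessible_space G.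
Hypothesis sequential : sequential_space G.

Lemma pseudocharacter_countable (W : nat -> set G) :
  (forall n, open (W n) /\ W n 1) -> (forall x, x <> 1 -> exists n, ~ W n x) ->
  [set: pseudocharacter G] #<= [set: nat].
Proof.
move=> W1 Wx; apply: min_card_le => x.
exists (range (fun n => [set z | W n (x^-1 * z)%g])); split.
- exact: card_image_le.
- by move=> _ [n _ <-]; apply: open_translate; have [] := W1 n.
- apply/seteqP; split=> [z zW|_ -> _ [n _ <-]]; last first.
    by rewrite /= mulVg; have [] := W1 n.
  apply: contrapT => zx; have [|n] := Wx (x^-1 * z)%g.
    by move=> /(congr1 (fun t => x * t)%g); rewrite mulVKg mulg1.
  apply; apply: (zW [set z | W n (x^-1 * z)%g]).
  by exists n.
Qed.

Lemma sb_character_le : [set: sb_character G] #<= [set: character G].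
Proof.
apply: sup_card_le => x.
have [|N [Nx NU] /card_eqW[NK _]] := @min_size_sat _ (nbhs_base x) (nbhs x).
  by split=> // U xU; exists U.
apply: card_le_trans (card_le_trans NK (sup_card_ge (fun x =>
  min_size (nbhs_base x)) x)).
apply: min_size_le; split=> [B /Nx xB u ux|U /NU[B NB BU]]; first exact: ux.
by exists B; split=> //; exact: nbhs_singleton (Nx _ NB).
Qed.

Lemma sb_network_at1 : exists2 N : set (set G), sb_network 1 N &
  N #<= [set: sb_character G].
Proof.
have [|N Nsb /card_eqW[NK _]] := @min_size_sat _ (sb_network 1) (nbhs 1).
  split=> [B B1 u u1|U U1]; first exact: u1.
  by exists U; split=> //; exact: nbhs_singleton.
exists N => //; apply: card_le_trans NK _.
exact: (sup_card_ge (fun x => min_size (sb_network x))).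
Qed.

Lemma character_le (N : set (set G)) (K : Type) : nbhs_base 1 N ->
  N #<= [set: K] -> [set: character G] #<= [set: K].
Proof.
move=> [N1 NU] NK; apply: sup_card_le => x.
apply: card_le_trans NK; pose T A := [set z | A (x^-1 * z)%g].
apply: card_le_trans (card_image_le T N); apply: min_size_le.
split=> [_ [A /N1 A1 <-]|U /nbhs_to1/NU[A NA AU]]; first exact: nbhs1_lmulg.
by exists (T A); [exists A|move=> z /AU; rewrite /= mulVKg].
Qed.

Lemma discrete_character : nbhs 1 [set 1] ->
  [set: sb_character G] #= [set: character G] /\ [set: character G] #= [set:
    unit].
Proof.
move=> G1.
have chi1 : [set: character G] #<= [set: unit].
  apply: (@character_le [set [set 1]]); first split.
  - by move=> _ ->.
  - by move=> U /nbhs_singleton U1; exists [set 1] => // _ ->.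
  - apply: (@card_le_rel _ _ _ _ (fun _ _ => True)) => [_ A B -> -> //|A _].
    by exists tt.
have sb1 : [set: unit] #<= [set: sb_character G].
  have [N [_ /(_ _ G1)[B [NB _ _]]] NK] := sb_network_at1.
  apply: card_le_trans NK.
  apply: (@card_le_rel _ _ _ _ (fun _ _ => True)) => [_ [] []//|_ _].
  by exists B.
have sbchi := sb_character_le.
split; first exact: card_le_anti sbchi (card_le_trans chi1 sb1).
exact: card_le_anti chi1 (card_le_trans sb1 sbchi).
Qed.

(** A sequence of points other than [1] tends to [1]. Finitely many barriers would contain a common
    term [u M], and none of them would fit in the complement of that point. *)
Lemma sb_character_infinite : ~ nbhs 1 [set 1] ->
  [set: nat] #<= [set: sb_character G].
Proof.
move=> nG1; have [N [Nbar NU] NK] := sb_network_at1.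
apply: card_le_trans NK; apply/infiniteP => -[n /card_eqW[/card_le_ex[R [Rtot _
  Rinj]] _]].
have [u [u1 uN1]] : exists u, u @ \oo --> 1 /\ forall k, u k <> 1.
  apply: contrapT => nu; apply: nG1; apply: open_nbhs_nbhs; split=> //.
  apply: (seq_open sequential) => u x -> u1; apply: contrapT => nk; apply: nu.
  by exists u; split=> // k uk; apply: nk; exists k.
have [i _|M MP] := @eventually_all_lt (fun i k => forall B, N B -> R B i ->
  B (u k)) n.
  have [[B [NB RB]]|nB] := pselect (exists B, N B /\ R B i); last first.
    by exists 0 => k _ B NB RB; case: nB; exists B.
  have [M _ MB] := Nbar B NB u u1.
  by exists M => k Mk B' NB' RB'; rewrite (Rinj B' B i)//; exact: MB.
have [B [NB _ BU]] := NU _ (nbhs_neq T1 (nesym (uN1 M))).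
have [i /= ilt RB] := Rtot B NB.
exact: BU (MP i M ilt (leqnn M) B NB RB) erefl.
Qed.

Lemma first_countable_character (V : nat -> set G) :
  (forall n, nbhs 1 (V n)) -> (forall U, nbhs 1 U -> exists n, V n `<=` U) ->
  ~ nbhs 1 [set 1] ->
  [set: sb_character G] #= [set: character G] /\ [set: character G] #= [set:
    nat].
Proof.
move=> V1 VU nG1; have sbchi := sb_character_le; have natsb :=
  sb_character_infinite nG1.
have chinat : [set: character G] #<= [set: nat].
  apply: (@character_le (range V)); last exact: card_image_le.
  split=> [_ [n _ <-]//|U /VU[n nU]]; by exists (V n) => //; exists n.
split; first exact: card_le_anti sbchi (card_le_trans chinat natsb).
exact: card_le_anti chinat (card_le_trans natsb sbchi).
Qed.

(** Each barrier yields a function bounding the entry time into it of every row. The points of the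
    rows up to [f n] form a closed set without [1], and the function of a barrier missing this set
    dominates [f]. *)
Lemma dominating_le_sb_character (w : nat -> nat -> G) : strong_fan setT w ->
  [set: dominating_number] #<= [set: sb_character G].
Proof.
move=> [_ w1 nw]; have [N [Nbar NU] NK] := sb_network_at1.
(* Only finitely many rows contain [1], since otherwise a constant selection would converge; these
   rows are skipped. *)
have [n0 wn0] : exists n0, forall n k, (n0 <= n)%N -> w n k <> 1.
  apply: contrapT => nn0.
  have /choice[h hP] : forall j, exists n, (j <= n)%N /\ exists k, w n k = 1.
    move=> j; apply: contrapT => nj; apply: nn0; exists j => n k jn wnk.
    by apply: nj; exists n; split=> //; exists k.
  have /choice[k kP] : forall j, exists k, w (h j) k = 1 by move=> j; have [] :=
    hP j.
  apply: (nw h k 1) => [j|]; first by have [] := hP j.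
  have -> : (fun j => w (h j) (k j)) = fun=> 1 by apply/funext => j; exact: kP.
  exact: cvg_cst.
have /choice[g gP] : forall B : set G, exists g : nat -> nat, N B ->
    forall n k, (g n <= k)%N -> B (w (n0 + n) k).
  move=> B; have [NB|nB] := pselect (N B); last by exists id.
  have /choice[g gP] : forall n, exists M, forall k, (M <= k)%N ->
    B (w (n0 + n) k).
    by move=> n; have [M _ MB] := Nbar B NB _ (w1 (n0 + n)); exists M => k /MB.
  by exists g.
apply: card_le_trans NK; apply: card_le_trans (card_image_le g N).
apply: min_size_le => f.
pose P := [set x | exists n k, (k <= f n)%N /\ x = w (n0 + n) k].
have Pcl : closed P.
  apply: (seq_closed sequential) => v x /choice[n /choice[k nkP]] vx.
  have [h [hge [hn|[c hc]]]] := unbounded_or_constant n.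
    case: (nw (fun j => n0 + n (h j)) (k \o h) x).
      by move=> j; apply: leq_trans (hn j) _; exact: leq_addl.
    have := cvg_subseq hge vx; apply: cvg_trans; apply: near_eq_cvg;
      apply: nearW => j /=.
    by have [_ ->] := nkP (h j).
  have [h' [h'ge [hk|[d hd]]]] := unbounded_or_constant (k \o h).
    have [kf _] := nkP (h (h' (f c).+1)); have := leq_trans (hk (f c).+1) kf.
    by rewrite [n _]hc ltnn.
  have vE j : v (h (h' j)) = w (n0 + c) d.
    by have [_ ->] := nkP (h (h' j)); rewrite [n _]hc [k _]hd.
  exists c, d; split; last first.
    apply: (cvg_uniq T1 (cvg_subseq h'ge (cvg_subseq hge vx))).
    have -> : (v \o h) \o h' = fun=> w (n0 + c) d by apply/funext => j;
      exact: vE.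
    exact: cvg_cst.
  by have [] := nkP (h (h' 0)); rewrite [n _]hc [k _]hd.
have [|B [NB _ BP]] := NU (~` P).
  apply: open_nbhs_nbhs; split; first exact: closed_openC.
  by move=> [n [k [_ /esym]]]; apply: wn0; exact: leq_addr.
exists (g B); first by exists B.
move=> n; rewrite leqNgt; apply/negP => lt.
apply: (BP (w (n0 + n) (f n))); first by apply: gP => //; exact: ltnW.
by exists n, (f n).
Qed.

Lemma dominating_character (w : nat -> nat -> G) (W : (nat -> nat) -> set G) :
  strong_fan setT w ->
  (forall f, open (W f) /\ W f 1) ->
  (forall f g, (forall n, (f n <= g n)%N) -> W g `<=` W f) ->
  (forall U, nbhs 1 U -> exists f, W f `<=` U) ->
  [set: sb_character G] #= [set: character G] /\
  [set: character G] #= [set: dominating_number].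
Proof.
move=> wfan W1 WS WU; have sbchi := sb_character_le.
have dsb := dominating_le_sb_character wfan.
have chid : [set: character G] #<= [set: dominating_number].
  have [|D Ddom /card_eqW[DK _]] := @min_size_sat _ (fun D : set (nat -> nat) =>
      forall f, exists2 g, D g & forall n, (f n <= g n)%N) setT.
    by move=> f; exists f.
  apply: (@character_le (W @` D)); last exact: card_le_trans (card_image_le _ _)
    DK.
  split=> [_ [f _ <-]|U /WU[f fU]]; first exact: open_nbhs_nbhs.
  have [g Dg fg] := Ddom f; exists (W g); first by exists g.
  exact: subset_trans (WS _ _ fg) fU.
split; first exact: card_le_anti sbchi (card_le_trans chid dsb).
exact: card_le_anti chid (card_le_trans dsb sbchi).
Qed.

(** The other invariants lie between the boundedness index and the k-network weight, so one bound of
    the latter by the former closes the circle. *)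
Lemma global_invariants :
  ([set: nat] #<= [set: boundedness_index G] ->
    [set: k_network_weight G] #<= [set: boundedness_index G]) ->
  [/\ [set: boundedness_index G] #= [set: cellularity G],
      [set: cellularity G] #= [set: density G],
      [set: density G] #= [set: lindelof_number G],
      [set: lindelof_number G] #= [set: extent G] &
      [set: extent G] #= [set: network_weight G] /\
      [set: network_weight G] #= [set: k_network_weight G]].
Proof.
move=> kinf.
have kib : [set: k_network_weight G] #<= [set: boundedness_index G].
  have [/kinf //|/(boundedness_finite T1) Gib] :=
    pselect ([set: nat] #<= [set: boundedness_index G]).
  (* A finite boundedness index bounds the size of [G], so [G] is finite, and singletons form a
     k-network. *)
  have [Gfin|/infiniteP Ginf] := pselect (finite_set [set: G]);
    last exact/kinf/(card_le_trans Ginf).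
  exact: card_le_trans (k_network_weight_le_card T1 Gfin) Gib.
have nwk := network_weight_le_k G.
have sand (K : Type) : [set: boundedness_index G] #<= [set: K] ->
    [set: K] #<= [set: network_weight G] -> [set: boundedness_index G] #= [set:
      K].
  by move=> ? ?; apply: card_le_anti => //; exact: card_le_trans (card_le_trans
    nwk kib).
have ic := sand _ (boundedness_le_cellularity G) (cellularity_le_network G).
have id := sand _ (boundedness_le_density G) (density_le_network G).
have il := sand _ (boundedness_le_lindelof G) (lindelof_le_network G).
have ie := sand _ (boundedness_le_extent T1) (extent_le_network G).
have [ice _] := card_eqW ie.
have iw := sand _ (card_le_trans ice (extent_le_network G)) (card_lexx _).
have [iw' _] := card_eqW iw.
have ik : [set: boundedness_index G] #= [set: k_network_weight G].
  exact: card_le_anti (card_le_trans iw' nwk) kib.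
have tr (K L : Type) : [set: boundedness_index G] #= [set: K] ->
    [set: boundedness_index G] #= [set: L] -> [set: K] #= [set: L].
  by move=> iK; apply: card_eq_trans; exact: card_esym.
by split; [| | | |split]; auto.
Qed.

End characters.

Unset Implicit Arguments.

Theorem theorem2 (G : topologicalGroupType) :
  accessible_space G -> sequential_space G ->
  [set: cs_star_character G] #<= [set: nat] ->
  [/\ [set: pseudocharacter G] #<= [set: nat],
      [set: sb_character G] #= [set: character G] /\
      [\/ [set: character G] #= [set: unit],
          [set: character G] #= [set: nat] |
          [set: character G] #= [set: dominating_number]],
      [/\ [set: boundedness_index G] #= [set: cellularity G],
          [set: cellularity G] #= [set: density G],
          [set: density G] #= [set: lindelof_number G],
          [set: lindelof_number G] #= [set: extent G] &
          [set: extent G] #= [set: network_weight G] /\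
          [set: network_weight G] #= [set: k_network_weight G]] &
      ord_eq (sequential_order G) ordinal1 \/
      ord_eq (sequential_order G) omega1].
Proof.
move=> T1 sequential /cs_star_sequence_exists[F Fcs].
(* With [Z = setT] the dichotomy separates the first countable case from the case of character
   [dominating_number] and sequential order [omega1]. *)
have [Dbar|[w wfan]] := fan_dichotomy Fcs setT.
  have [B Bb] := barrier_base_exists Dbar.
  have [V [V1 VU]] := first_countable_of_barriers sequential Bb.
  split.
  - apply: (pseudocharacter_countable (W := fun n => (V n)°)) =>
      [n|x /nesym/(nbhs_neq T1)/VU[n nx]].
      by split; [exact: open_interior|exact: nbhs_singleton (nbhs_interior (V1
        n))].
    by exists n => /interior_subset/nx.
  - have [G1|nG1] := pselect (nbhs (1%g : G) [set 1%g]).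
      by have [? ?] := discrete_character G1; split=> //; constructor 1.
    by have [? ?] := first_countable_character T1 sequential V1 VU nG1;
      split=> //; constructor 2.
  - exact: global_invariants T1 (first_countable_k_network V1 VU).
  - by left; exact: sequential_order1_of_barriers Bb.
have [L Lt] := tower_exists T1 sequential Fcs wfan.
split.
- by have [W [W1 Wx]] := tower_points T1 sequential Fcs Lt;
    exact: pseudocharacter_countable Wx.
- have [W [W1 WS WU]] := tower_neighborhoods sequential Fcs Lt.
  by have [? ?] := dominating_character T1 sequential wfan W1 WS WU; split=> //;
    constructor 3.
- exact: global_invariants T1 (tower_k_network T1 sequential Fcs Lt).
- by right; exact: (sequential_order_tower T1 sequential Lt wfan).
Qed.
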